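(* Let $d\ge1$, $q_1,\dots,q_d\in\mathbb{Z}_{>0}$ and $\Lambda=q_1\mathbb{Z}\oplus\cdots\oplus q_d\mathbb{Z}$. If at least one of the periods $q_j$ is greater than $3$, then there exists a nonzero $\Lambda$-periodic potential $V:\mathbb{Z}^d\to\mathbb{C}$ that is Floquet isospectral to the zero potential $\mathbf{0}$. If all $q_j\le 3$ and at most two of the $q_j$ are equal to $3$, then the only $\Lambda$-periodic potential Floquet isospectral to $\mathbf{0}$ is $V\equiv\mathbf{0}$.
   Context: The discrete Laplacian on $\mathbb{Z}^d$ is $(\Delta u)(n)=\sum_{n'\in\mathbb{Z}^d,\ |n'-n|_1=1}u(n')$, where $|x|_1=\sum_i|x_i|$. A potential $V:\mathbb{Z}^d\to\mathbb{C}$ is $\Lambda$-periodic if $V(n+m)=V(n)$ for all $n\in\mathbb{Z}^d$, $m\in\Lambda$; it acts as a multiplication operator. Let $\delta_1,\dots,\delta_d$ be the standard basis vectors and $\mathbb{T}$ the complex unit circle. For $z=(z_1,\dots,z_d)\in\mathbb{T}^d$, the operator $\Delta+V$ preserves the $q=q_1\cdots q_d$-dimensional space of functions $u:\mathbb{Z}^d\to\mathbb{C}$ satisfying $u(n+q_j\delta_j)=z_ju(n)$ for all $n$ and $j$ (such $u$ are determined by their values on $\{0\le n_i<q_i\}$); let $L_V(z)$ be the $q\times q$ matrix of this restriction and $\sigma_V(z)$ its multiset of eigenvalues with algebraic multiplicity. Two $\Lambda$-periodic potentials $V,V'$ are Floquet isospectral if $\sigma_V(z)=\sigma_{V'}(z)$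 for all $z\in\mathbb{T}^d$. *)

(* Defs.v *)
From HB Require Import structures.
From mathcomp Require Import all_boot all_order all_algebra.
From mathcomp Require Import complex.
From mathcomp Require Import reals.

Set Implicit Arguments.
Unset Strict Implicit.
Unset Printing Implicit Defensive.

Import Order.TTheory GRing.Theory Num.Theory.
Local Open Scope ring_scope.
Local Open Scope complex_scope.

Section Floquet.
Variable R : realType.
Notation C := (R[i]).
Variable d : nat.
Variable q : 'I_d -> nat.

Definition pt := 'rV[int]_d.

Definition delta (j : 'I_d) : pt := delta_mx 0 j.

Definition periodic (V : pt -> C) : Prop :=
  forall n m : pt, (forall j, (q j %| m ord0 j)%Z) -> V (n + m) = V n.

Definition box := {dffun forall j : 'I_d, 'I_(q j)}.

Definition box_pt (a : box) : pt := \row_j ((a j : nat)%:Z).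

Definition red_eq (n : pt) (b : box) : bool :=
  [forall j, (n ord0 j %% (q j)%:Z)%Z == ((b j : nat)%:Z)].

Definition quot (n : pt) (j : 'I_d) : int := (n ord0 j %/ (q j)%:Z)%Z.

(* Floquet factor for u(n) = (prod_j z_j^{k_j}) u(r) *)
Definition ffactor (z : 'I_d -> C) (n : pt) : C :=
  \prod_(j < d) (z j) ^ (quot n j).

(* Entry (a,b) of the matrix of Delta + V on the space of functions with
   u(n + q_j delta_j) = z_j u(n), in the basis given by the values on
   the box: (Delta u)(a) = sum over neighbours n' = a +/- delta_i of u(n'). *)
Definition Lentry (V : pt -> C) (z : 'I_d -> C) (a b : box) : C :=
  (a == b)%:R * V (box_pt a)
  + \sum_(i < d) \sum_(s : bool)
      let n' := box_pt a + (if s then delta i else - delta i) in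
      (red_eq n' b)%:R * ffactor z n'.

Definition LV (V : pt -> C) (z : 'I_d -> C) : 'M[C]_#|box| :=
  \matrix_(i, j) Lentry V z (enum_val i) (enum_val j).

(* sigma_V(z): multiset of eigenvalues with algebraic multiplicity,
   given as the multiplicity function lambda |-> mult. of lambda as a
   root of the characteristic polynomial *)
Definition sigma (V : pt -> C) (z : 'I_d -> C) : C -> nat :=
  fun lam => mup lam (char_poly (LV V z)).

Definition on_torus (z : 'I_d -> C) : Prop := forall j, `|z j| = 1.

Definition floquet_isospectral (V V' : pt -> C) : Prop :=
  forall z, on_torus z -> forall lam, sigma V z lam = sigma V' z lam.

End Floquet.

(* Main.v *)
Require Import Defs.
From HB Require Import structures.
From mathcomp Require Import all_boot all_order all_algebra fingroup perm separable cyclic spectral.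
From mathcomp Require Import complex.
From mathcomp Require Import reals.
From mathcomp Require boolp.
From mathcomp Require Import mpoly ring zify.
Set Implicit Arguments.
Unset Strict Implicit.
Unset Printing Implicit Defensive.
Import Order.TTheory GRing.Theory Num.Theory.
Local Open Scope ring_scope.

(** Writing z_j = zeta_j ^ q_j, the Floquet matrix is conjugate to V plus the hopping terms
    zeta_i S_i + zeta_i^-1 S_i^-1, where S_i is the cyclic shift of Z/q_i.

    If q_j > 3, look for V depending on the j-th coordinate only. By triangularizing the j-th
    factor this becomes a one-dimensional problem on Z/q, and for an antisymmetric potential v with
    m = q/2 unknowns the difference of the characteristic polynomials has just m coefficients F_j,
    independent of zeta, and a common zero v <> 0 of the F_j is needed. Evaluating the difference at
    the eigenvalues of the free operator shows that combinations of the F_j have the squares of the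
    Fourier coefficients of v as lowest terms, and evaluating it at the entries of v shows that the
    ideal of the F_j contains polynomials x_i^q - (lower order). If 0 were the
    only common zero, all monomials of degree > m would lie in a proper ideal which, by the theory of
    the global residue, does not contain a certain monomial of degree m^2.

    If all q_j <= 3, the choice zeta_j = i kills the hopping in all directions with q_j <= 2.
    With no period 3 the operator is then diagonal. With one, the spectrum of each 3 x 3
    block is that of the free block, and V = 0 follows from the coefficients. With two, letting zeta
    tend to infinity along a one-parameter family leaves the problem averaged over a line of (Z/3)^2;
    so the averages of V over the lines of all four directions vanish, hence V does. *)

(** * Order and degree of polynomials, and the global residue functional *)

Section Residue.
Variables (K : fieldType) (m e : nat) (L : 'I_m -> {mpoly K[m]}).

(** Order at least [n] at the origin and, in [dle], total degree at most [n]. Stated on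
    coefficients, both hold for the zero polynomial without a special case. *)
Definition dge n (p : {mpoly K[m]}) := forall a : 'X_{1..m}, (mdeg a < n)%N -> p@_a = 0.
Definition dle n (p : {mpoly K[m]}) := forall a : 'X_{1..m}, (n < mdeg a)%N -> p@_a = 0.

Lemma dgeD n p r : dge n p -> dge n r -> dge n (p + r).
Proof. by move=> hp hr a ha; rewrite mcoeffD hp ?hr ?addr0. Qed.

Lemma dgeN n p : dge n p -> dge n (- p).
Proof. by move=> hp a ha; rewrite mcoeffN hp ?oppr0. Qed.

Lemma dgeZ n c p : dge n p -> dge n (c *: p).
Proof. by move=> hp a ha; rewrite mcoeffZ hp ?mulr0. Qed.

Lemma dge0 n : dge n 0.
Proof. by move=> a _; rewrite mcoeff0. Qed.

Lemma dge_sum n (I : Type) (r : seq I) (P : pred I) F :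
  (forall i, P i -> dge n (F i)) -> dge n (\sum_(i <- r | P i) F i).
Proof. by move=> h; elim/big_rec: _ => [|i x Pi hx]; [exact: dge0|apply: dgeD => //; exact: h]. Qed.

Lemma dgeW n k p : (k <= n)%N -> dge n p -> dge k p.
Proof. by move=> kn hp a ha; apply: hp; apply: leq_trans kn. Qed.

Lemma dgeM n k p r : dge n p -> dge k r -> dge (n + k) (p * r).
Proof.
move=> hp hr a ha; rewrite mcoeffM big1 // => -[b c] /= /eqP /(congr1 (@mdeg m)).
rewrite mdegD => hbc.
case: (ltnP (mdeg b) n) => hb; first by rewrite hp ?mul0r.
by rewrite hr ?mulr0 //; lia.
Qed.

Lemma dgeX a : dge (mdeg a) 'X_[a].
Proof. by move=> b hb; rewrite mcoeffX; case: eqP => // eab; rewrite eab ltnn in hb. Qed.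

Lemma dge_all p : dge 0 p. Proof. by []. Qed.

Lemma dge_prod (I : finType) (F : I -> {mpoly K[m]}) (n : I -> nat) :
  (forall i, dge (n i) (F i)) -> dge (\sum_i n i) (\prod_i F i).
Proof.
move=> h; elim/big_rec2: _ => [|i x y _ hx]; first exact: dge_all.
exact: dgeM.
Qed.

Lemma dleD n p r : dle n p -> dle n r -> dle n (p + r).
Proof. by move=> hp hr a ha; rewrite mcoeffD hp ?hr ?addr0. Qed.

Lemma dleN n p : dle n p -> dle n (- p).
Proof. by move=> hp a ha; rewrite mcoeffN hp ?oppr0. Qed.

Lemma dle0 n : dle n 0.
Proof. by move=> a _; rewrite mcoeff0. Qed.

Lemma dle1 : dle 0 1.
Proof. by move=> a ha; rewrite mcoeff1; case: eqP ha => // ->; rewrite mdeg0. Qed.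

Lemma dleW n k p : (n <= k)%N -> dle n p -> dle k p.
Proof. by move=> kn hp a ha; apply: hp; apply: leq_ltn_trans ha. Qed.

Lemma dle_sum n (I : Type) (r : seq I) (P : pred I) F :
  (forall i, P i -> dle n (F i)) -> dle n (\sum_(i <- r | P i) F i).
Proof. by move=> h; elim/big_rec: _ => [|i x Pi hx]; [exact: dle0|apply: dleD => //; exact: h]. Qed.

Lemma dleM n k p r : dle n p -> dle k r -> dle (n + k) (p * r).
Proof.
move=> hp hr a ha; rewrite mcoeffM big1 // => -[b c] /= /eqP /(congr1 (@mdeg m)).
rewrite mdegD => hbc.
case: (ltnP n (mdeg b)) => hb; first by rewrite hp ?mul0r.
by rewrite hr ?mulr0 //; lia.
Qed.

Lemma dle_prod (I : finType) (F : I -> {mpoly K[m]}) (n : I -> nat) :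
  (forall i, dle (n i) (F i)) -> dle (\sum_i n i) (\prod_i F i).
Proof.
move=> h; elim/big_rec2: _ => [|i x y _ hx]; first exact: dle1.
exact: dleM.
Qed.

Lemma dleXn n k p : dle n p -> dle (k * n) (p ^+ k).
Proof.
move=> h; elim: k => [|k IH]; first by rewrite expr0; exact: dle1.
by rewrite exprS mulSn; apply: dleM.
Qed.

Lemma dleX a : dle (mdeg a) 'X_[a].
Proof. by move=> b hb; rewrite mcoeffX; case: eqP => // eab; rewrite eab ltnn in hb. Qed.

Lemma dle_msize p : dle (msize p).-1 p.
Proof.
move=> a ha; apply/eqP; rewrite mcoeff_eq0; apply: msize_mdeg_ge.
by move: ha; case: (msize p).
Qed.

Definition mons B : seq 'X_{1..m} := [seq val x | x <- enum {: 'X_{1..m < B}}].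

Lemma mem_mons B a : (a \in mons B) = (mdeg a < B)%N.
Proof.
apply/mapP/idP => [[x _ ->]|h]; first exact: bmdeg.
by exists (BMultinom h) => //; rewrite mem_enum.
Qed.

Lemma mons_uniq B : uniq (mons B).
Proof. by rewrite map_inj_uniq ?enum_uniq //; exact: val_inj. Qed.

Definition tgt (n : 'X_{1..m}) := [multinom (e.+1 * n i + e)%N | i < m].
Definition Lpow (n : 'X_{1..m}) := \prod_i L i ^+ n i.
Definition rhoB B h := \sum_(n <- mons B) (h * Lpow n)@_(tgt n).
(* The global residue of [h] with respect to the system ['X_i ^+ e.+1 - L i],
   read off the expansion of [1 / ('X_i ^+ e.+1 - L i)] in powers of [L i]. *)
Definition rho h := rhoB (msize h) h.

Hypothesis hL : forall i, dle e (L i).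

Lemma mdeg_tgt n : mdeg (tgt n) = (e.+1 * mdeg n + m * e)%N.
Proof.
rewrite !mdegE big_distrr /= -[m in (m * e)%N]card_ord -sum_nat_const -big_split /=.
by apply: eq_bigr => i _; rewrite mnmE.
Qed.

Lemma dle_Lpow n : dle (e * mdeg n) (Lpow n).
Proof.
rewrite mdegE big_distrr /=; apply: dle_prod => i.
by rewrite mulnC; apply: dleXn.
Qed.

(** A factor [L i] adds at most [e] to the degree but [e.+1] to the degree of the target, which
    therefore outgrows [h * Lpow n]. So the sum over all [n] is finite, and every large enough
    truncation gives [rho]. *)
Lemma rho_term0 D h n : dle D h -> (D < mdeg n + m * e)%N -> (h * Lpow n)@_(tgt n) = 0.
Proof.
move=> hh hn; apply: (dleM hh (@dle_Lpow n)).
by rewrite mdeg_tgt mulSn; lia.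
Qed.

Lemma rhoBE B h : (msize h <= B)%N -> rhoB B h = rho h.
Proof.
move=> hB; rewrite /rho /rhoB (bigID (fun n => mdeg n < msize h)%N) /=.
rewrite [X in _ + X]big1 ?addr0 => [|n hn].
  rewrite -big_filter; apply: perm_big; apply: uniq_perm; rewrite ?filter_uniq ?mons_uniq //.
  by move=> a; rewrite mem_filter !mem_mons; lia.
have [->|h0] := eqVneq h 0; first by rewrite mul0r mcoeff0.
apply: (rho_term0 (@dle_msize h)); have : (0 < msize h)%N by rewrite lt0n msize_poly_eq0.
by lia.
Qed.

Lemma rhoD h1 h2 : rho (h1 + h2) = rho h1 + rho h2.
Proof.
pose B := (msize h1 + msize h2 + msize (h1 + h2))%N.
rewrite -!(@rhoBE B) /B; try lia.
by rewrite /rhoB -big_split; apply: eq_bigr => n _; rewrite mulrDl mcoeffD.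
Qed.

Lemma rhoZ c h : rho (c *: h) = c * rho h.
Proof.
pose B := (msize h + msize (c *: h))%N.
rewrite -!(@rhoBE B) /B; try lia.
by rewrite /rhoB mulr_sumr; apply: eq_bigr => n _; rewrite -scalerAl mcoeffZ.
Qed.

Lemma mcoeffXM_eq0 (a b : 'X_{1..m}) (p : {mpoly K[m]}) i : (a i < b i)%N -> ('X_[b] * p)@_a = 0.
Proof.
move=> hab; rewrite mcoeffM big1 // => -[c d] /= /eqP /(congr1 (fun x : 'X_{1..m} => x i)).
rewrite mnmDE mcoeffX => ea.
case: (b =P _) => [eb|]; last by rewrite mul0r.
by move: hab; rewrite ea -eb ltnNge leq_addr.
Qed.

Lemma mcoeffXMD (a b : 'X_{1..m}) (p : {mpoly K[m]}) : ('X_[b] * p)@_(a + b) = p@_a.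
Proof. by rewrite mulrC addmC mcoeffMX. Qed.

(** Multiplication by ['X_i ^+ e.+1] amounts to shifting the summation index by [U_(i)], that is, to
    one more factor [L i]. *)
Lemma rho_shift i (h : {mpoly K[m]}) : rho ('X_i ^+ e.+1 * h) = rho (L i * h).
Proof.
pose B := (msize ('X_i ^+ e.+1 * h) + msize (L i * h))%N.
rewrite -(@rhoBE B.+1) -?(@rhoBE B) /B; try lia.
(* The terms with [n i = 0] drop out: their target has exponent [e] in ['X_i], too small for a
   multiple of ['X_i ^+ e.+1]. *)
rewrite /rhoB (bigID (fun n : 'X_{1..m} => n i == 0%N)) /= big1 ?add0r => [|n /eqP hn]; last first.
  by rewrite mpolyXn -mulrA (@mcoeffXM_eq0 _ _ _ i) // mulmnE mnm1E eqxx mnmE hn; lia.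
rewrite -big_filter.
transitivity (\sum_(n <- [seq (a + U_(i))%MM | a <- mons B]) ('X_i ^+ e.+1 * h * Lpow n)@_(tgt n)).
  apply: perm_big; apply: uniq_perm.
  - by rewrite filter_uniq ?mons_uniq.
  - by rewrite map_inj_uniq ?mons_uniq // => a b /addIm.
  move=> a; rewrite mem_filter mem_mons; apply/idP/mapP => [/andP[ai da]|[b hb ->]].
    have ha : (a - U_(i) + U_(i) = a)%MM by rewrite submK // lep1mP.
    exists (a - U_(i))%MM; last by rewrite ha.
    by move: da; rewrite -{1}ha mdegD mdeg1 mem_mons addn1.
  by move: hb; rewrite mem_mons mnmDE mnm1E eqxx mdegD mdeg1 !addn1 ltnS.
rewrite big_map; apply: eq_bigr => n _.
have -> : Lpow (n + U_(i))%MM = L i * Lpow n.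
  rewrite /Lpow (bigD1 i) //= [in RHS](bigD1 i) //= mnmDE mnm1E eqxx addn1 exprS -mulrA.
  congr (_ * (_ * _)); apply: eq_bigr => j ji.
  by rewrite mnmDE mnm1E eq_sym (negPf ji) addn0.
have -> : tgt (n + U_(i))%MM = (tgt n + U_(i) *+ e.+1)%MM.
  apply/mnmP => j; rewrite mnmDE mulmnE !mnmE.
  by case: (i == j); rewrite ?addn0 ?mul1n ?mul0n ?mulnDr ?muln1 ?muln0 ?addn0 //; lia.
by rewrite mpolyXn -mulrA mcoeffXMD mulrA [h * _]mulrC.
Qed.

Lemma rho_ideal i h : rho (('X_i ^+ e.+1 - L i) * h) = 0.
Proof. by rewrite mulrBl -scaleN1r rhoD rhoZ mulN1r rho_shift subrr. Qed.

(* In degree [m * e] only the leading forms ['X_i ^+ e.+1] matter. *)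
Lemma rho_top h : dle (m * e) h -> rho h = h@_[multinom e | i < m].
Proof.
move=> hh; rewrite -(@rhoBE (msize h).+1) // /rhoB (bigD1_seq 0%MM) ?mons_uniq ?mem_mons ?mdeg0 //=.
rewrite [X in _ + X]big1 ?addr0 => [|n n0]; last first.
  by apply: (rho_term0 hh); move: n0; rewrite -mdeg_eq0; lia.
have -> : Lpow 0%MM = 1 by rewrite /Lpow big1 // => i _; rewrite mnm0E expr0.
by rewrite mulr1; congr (h @_ _); apply/mnmP => i; rewrite !mnmE muln0.
Qed.
End Residue.

(** * A nonzero common zero of the [F j] from the residue functional *)

Section CommonZero.
Variables (K : closedFieldType) (m e : nat) (L F : 'I_m -> {mpoly K[m]}).
Variables (w : 'I_m -> {mpoly K[m]}) (c : 'I_m -> 'I_m -> K).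
Hypothesis hm : (1 < m)%N.
Hypothesis hme : (2 * m <= e.+1)%N.
Hypothesis hL : forall i, dle e (L i).
Hypothesis hF : forall i, \sum_(j < m) F j * 'X_i ^+ (e.+1 - 2 * j.+1) = 'X_i ^+ e.+1 - L i.
Hypothesis hw1 : forall k, dge 1 (w k).
Hypothesis hXw : forall i, 'X_i = \sum_k c i k *: w k.
Hypothesis hFw : forall k, exists a : 'I_m -> K, dge 3 (\sum_j a j *: F j - w k ^+ 2).

Notation rho := (rho e L).
(** The largest ideal inside the kernel of [rho]. The arguments below are linear algebra in the
    quotient by it, where [annih p] means that [p] is zero. *)
Definition annih (p : {mpoly K[m]}) := forall h, rho (p * h) = 0.

Lemma annihD p r : annih p -> annih r -> annih (p + r).
Proof. by move=> hp hr h; rewrite mulrDl rhoD ?hp ?hr ?addr0. Qed.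

Lemma annihZ a p : annih p -> annih (a *: p).
Proof. by move=> hp h; rewrite -scalerAl rhoZ ?hp ?mulr0. Qed.

Lemma annih0 : annih 0.
Proof. by move=> h; rewrite -(scale0r 1) -scalerAl rhoZ // mul0r. Qed.

Lemma annih_sum (I : Type) (r : seq I) (P : pred I) G :
  (forall i, P i -> annih (G i)) -> annih (\sum_(i <- r | P i) G i).
Proof. by move=> h; elim/big_rec: _ => [|i x Pi hx]; [exact: annih0|apply: annihD => //; exact: h]. Qed.

Lemma annihMr p r : annih p -> annih (p * r).
Proof. by move=> hp h; rewrite -mulrA. Qed.

Lemma annihMl p r : annih r -> annih (p * r).
Proof. by move=> hp; rewrite mulrC; apply: annihMr. Qed.

Lemma annihN p : annih p -> annih (- p).
Proof. by rewrite -scaleN1r; apply: annihZ. Qed.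

Lemma annih_rel i : annih ('X_i ^+ e.+1 - L i).
Proof. by move=> h; rewrite rho_ideal. Qed.

(** The determinant of the system [hF], which expresses the relations through the [F j]. By the
    transformation law of residues, [h] going to [rho (jac * h)] is the residue functional of the
    [F j]. *)
Definition jac : {mpoly K[m]} := \det (\matrix_(i, j < m) 'X_i ^+ (e.+1 - 2 * j.+1)).

(** Cramer's rule: the adjugate matrix writes [jac * F j] as a combination of the relations. *)
Lemma annih_jacF j : annih (jac * F j).
Proof.
pose M : 'M[{mpoly K[m]}]_m := \matrix_(i, j < m) 'X_i ^+ (e.+1 - 2 * j.+1).
have hMF : M *m (\col_j F j) = \col_i ('X_i ^+ e.+1 - L i).
  by apply/colP => i; rewrite !mxE -hF; apply: eq_bigr => k _; rewrite !mxE mulrC.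
have : (\adj M *m (M *m (\col_j F j))) j 0 = jac * F j.
  by rewrite mulmxA mul_adj_mx mul_scalar_mx !mxE.
rewrite hMF mxE => <-; apply: annih_sum => i _; apply: annihMl; rewrite mxE.
exact: annih_rel.
Qed.

Definition boxmon (a : {ffun 'I_m -> 'I_e.+1}) : {mpoly K[m]} := 'X_[[multinom (a i : nat) | i < m]].
Definition spanned p := exists k : {ffun 'I_m -> 'I_e.+1} -> K, annih (p - \sum_a k a *: boxmon a).

Lemma spanned0 : spanned 0.
Proof. by exists (fun _ => 0); rewrite big1 ?subr0 => [|a _]; [exact: annih0|rewrite scale0r]. Qed.

Lemma spannedD p r : spanned p -> spanned r -> spanned (p + r).
Proof.
move=> [k hk] [l hl]; exists (fun a => k a + l a).
rewrite (eq_bigr (fun a => k a *: boxmon a + l a *: boxmon a)) => [|a _]; last by rewrite scalerDl.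
by rewrite big_split opprD addrACA; apply: annihD.
Qed.

Lemma spannedZ b p : spanned p -> spanned (b *: p).
Proof.
move=> [k hk]; exists (fun a => b * k a).
rewrite (eq_bigr (fun a => b *: (k a *: boxmon a))) => [|a _]; last by rewrite scalerA.
by rewrite -scaler_sumr -scalerBr; apply: annihZ.
Qed.

Lemma spanned_annih p r : annih (p - r) -> spanned r -> spanned p.
Proof. by move=> h [k hk]; exists k; have := annihD h hk; rewrite addrA subrK. Qed.

(** Trading ['X_i ^+ e.+1] for [L i] lowers the degree, so the quotient is spanned by the monomials
    with all exponents at most [e]; it is finite dimensional. *)
Lemma spanned_all p : spanned p.
Proof.
suff mono D : forall a : 'X_{1..m}, (mdeg a < D)%N -> spanned 'X_[a].
  rewrite [p]mpolyE; elim/big_rec: _ => [|a x _ hx]; first exact: spanned0.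
  by apply: spannedD => //; apply: spannedZ; apply: (mono (mdeg a).+1).
elim: D => // D IH a; rewrite ltnS => aD.
have [/forallP ha|] := boolP [forall i, (a i < e.+1)%N].
  pose b := [ffun i => Ordinal (ha i)].
  exists (fun x => (x == b)%:R); rewrite (bigD1 b) //= big1 => [|x xb]; last first.
    by rewrite (negPf xb) scale0r.
  rewrite eqxx scale1r addr0 /boxmon (_ : [multinom _ | _ < _] = a) ?subrr; first exact: annih0.
  by apply/mnmP => i; rewrite mnmE ffunE.
rewrite negb_forall; case/existsP => i; rewrite -leqNgt => ai.
have ea : a = (a - U_(i) *+ e.+1 + U_(i) *+ e.+1)%MM.
  rewrite submK //; apply/mnm_lepP => j; rewrite mulmnE mnm1E.
  by case: eqP => [<-|]; rewrite ?mul1n ?mul0n.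
set a' := (a - _)%MM in ea.
apply: (@spanned_annih _ ('X_[a'] * L i)).
  by rewrite ea mpolyXD -mpolyXn -mulrBr; apply: annihMl; apply: annih_rel.
have hd : (mdeg a' + e.+1 = mdeg a)%N by rewrite ea mdegD mdegMn mdeg1 mul1n.
have hdl : dle (mdeg a' + e) ('X_[a'] * L i) by apply: dleM => //; exact: dleX.
rewrite [X in spanned X]mpolyE big_seq; elim/big_rec: _ => [|b x hb hx]; first exact: spanned0.
apply: spannedD => //; apply: spannedZ; apply: IH.
rewrite ltnNge; apply/negP => Db; move: hb; rewrite mcoeff_msupp hdl ?eqxx //; lia.
Qed.

(** The [N.+1] first powers of ['X_i] lie in a space spanned by [N] elements, hence satisfy a linear
    relation. *)
Lemma annih_poly i : exists2 g : {poly K}, g != 0 & annih (\sum_(k < size g) g`_k *: 'X_i ^+ k).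
Proof.
pose N := #|{ffun 'I_m -> 'I_e.+1}|.
have [k hk] := @fin_all_exists _ _ _ (fun n : 'I_N.+1 => spanned_all ('X_i ^+ n)).
pose M : 'M[K]_(N.+1, N) := \matrix_(n, b) k n (enum_val b).
have kerM : kermx M != 0.
  by rewrite kermx_eq0 /row_free; apply/eqP => h; have := rank_leq_col M; rewrite h ltnn.
pose u := nz_row (kermx M).
have u0 : u != 0 by rewrite nz_row_eq0.
have uM : u *m M = 0 by apply/sub_kermxP; exact: nz_row_sub.
exists (\poly_(n < N.+1) u 0 (inord n)).
  apply: contraNneq u0 => g0; apply/eqP/rowP => n; rewrite mxE.
  by have := coef_poly N.+1 (fun n => u 0 (inord n)) n; rewrite g0 coef0 ltn_ord inord_val.
set g := \poly_(_ < _) _.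
have -> : \sum_(n < size g) g`_n *: 'X_i ^+ n = \sum_(n < N.+1) u 0 n *: 'X_i ^+ n :> {mpoly K[m]}.
  rewrite (big_ord_widen N.+1 (fun n => g`_n *: 'X_i ^+ n)) ?size_poly // big_mkcond.
  apply: eq_bigr => n _; rewrite coef_poly ltn_ord inord_val; case: ltnP => // hn.
  have := coef_poly N.+1 (fun n => u 0 (inord n)) n; rewrite -/g nth_default // ltn_ord inord_val => <-.
  by rewrite scale0r.
have -> : \sum_(n < N.+1) u 0 n *: 'X_i ^+ n =
    \sum_(n < N.+1) u 0 n *: ('X_i ^+ n - \sum_a k n a *: boxmon a).
  transitivity (\sum_(n < N.+1) (u 0 n *: 'X_i ^+ n) - \sum_(n < N.+1) u 0 n *: (\sum_a k n a *: boxmon a)).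
    rewrite [X in _ - X](_ : _ = 0) ?subr0 //.
    rewrite (eq_bigr (fun n : 'I_N.+1 => \sum_a (u 0 n * k n a) *: boxmon a)) => [|n _]; last first.
      by rewrite scaler_sumr; apply: eq_bigr => a _; rewrite scalerA.
    rewrite exchange_big big1 //= => a _; rewrite -scaler_suml.
    have /rowP/(_ (enum_rank a)) := uM; rewrite !mxE => h.
    rewrite [X in X *: _](_ : _ = 0) ?scale0r // -[RHS]h; apply: eq_bigr => n _.
    by rewrite mxE enum_rankK.
  by rewrite -sumrB; apply: eq_bigr => n _; rewrite scalerBr.
by apply: annih_sum => n _; apply: annihZ.
Qed.

(** Finds an eigenvector of multiplication by ['X_i] among the multiples of [p], by applying the
    linear factors one at a time until the result vanishes. *)
Lemma annih_split i p (s : seq K) :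
  annih (\prod_(r <- s) ('X_i - r%:MP) * p) -> ~ annih p ->
  exists r h, annih (('X_i - r%:MP) * (h * p)) /\ ~ annih (h * p).
Proof.
elim: s p => [|r s IH] p; first by rewrite big_nil mul1r => h /(_ h).
rewrite big_cons -mulrA => hs hp.
have [h1|h1] := boolp.EM (annih (('X_i - r%:MP) * p)).
  by exists r, 1; rewrite mul1r; split.
have [|r' [h [hr hh]]] := IH (('X_i - r%:MP) * p) _ h1; first by rewrite mulrCA.
by exists r', (h * ('X_i - r%:MP)); rewrite -mulrA; split.
Qed.

(** The same search with a nonzero eigenvalue: factors with root 0 contribute only powers of ['X_i],
    and these do not kill [p]. *)
Lemma annih_split_neq0 i p (s : seq K) :
  annih (\prod_(r <- s) ('X_i - r%:MP) * p) -> (forall k, ~ annih ('X_i ^+ k * p)) ->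
  exists r h, [/\ r != 0, annih (('X_i - r%:MP) * (h * p)) & ~ annih (h * p)].
Proof.
elim: s p => [|r s IH] p; first by rewrite big_nil mul1r => h /(_ 0%N); rewrite expr0 mul1r.
rewrite big_cons -mulrA => hs hp.
have [[k hk]|h1] := boolp.EM (exists k, annih ('X_i ^+ k * (('X_i - r%:MP) * p))).
  have [r0|r0] := eqVneq r 0; last first.
    by exists r, ('X_i ^+ k); split=> //; rewrite mulrCA.
  by case: (hp k.+1); move: hk; rewrite r0 mpolyC0 subr0 mulrA -exprSr.
have [|k hk|r' [h [hr0 hr hh]]] := IH (('X_i - r%:MP) * p).
- by rewrite mulrCA.
- by apply: h1; exists k.
by exists r', (h * ('X_i - r%:MP)); rewrite -mulrA; split.
Qed.

Lemma annih_roots i : exists s : seq K, annih (\prod_(r <- s) ('X_i - r%:MP)).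
Proof.
have [g g0 hg] := annih_poly i.
have [s es] := closed_field_poly_normal g.
exists s; set P := \prod_(_ <- _) _.
have -> : P = (lead_coef g)^-1 *: \sum_(k < size g) g`_k *: 'X_i ^+ k.
  have -> : \sum_(k < size g) g`_k *: 'X_i ^+ k = horner_alg ('X_i : {mpoly K[m]}) g.
    rewrite -[in RHS](coefK g) poly_def linear_sum; apply: eq_bigr => k _ /=.
    by rewrite linearZ /= rmorphXn /= horner_algX mulr_algl.
  rewrite {2}es linearZ /= mulr_algl scalerA mulVf ?lead_coef_eq0 // scale1r rmorph_prod.
  by apply: eq_bigr => r _; rewrite rmorphB /= horner_algX horner_algC alg_mpolyC.
exact: annihZ.
Qed.

Definition eigen p (a : 'I_m -> K) := forall i, annih (('X_i - (a i)%:MP) * p).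

(** The multiplications by the variables commute, so an eigenvector for some of them can be refined
    to one for a further variable. *)
Lemma common_eigen p (t : seq 'I_m) : ~ annih p ->
  exists h (a : 'I_m -> K), ~ annih (h * p) /\ {in t, forall i, annih (('X_i - (a i)%:MP) * (h * p))}.
Proof.
move=> hp; elim: t => [|i t [h [a [hh ha]]]]; first by exists 1, (fun _ => 0); rewrite mul1r; split.
have [s hs] := annih_roots i.
have [r [h' [hr hh']]] := annih_split (annihMr (h * p) hs) hh.
exists (h' * h), (fun j => if j == i then r else a j); rewrite -mulrA; split=> // j.
rewrite inE; case: eqP => [->|_] //= jt.
by rewrite mulrCA; apply: annihMl; apply: ha.
Qed.

(** The polynomials that act on [p] as the scalar given by their value at [a] form a subalgebra, and
    it contains the variables. *)
Lemma eigen_eval p a g : eigen p a -> annih ((g - (g.@[a])%:MP) * p).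
Proof.
move=> ha; pose E (g : {mpoly K[m]}) := annih ((g - (g.@[a])%:MP) * p).
have EM g1 g2 : E g1 -> E g2 -> E (g1 * g2).
  move=> h1 h2; rewrite /E mevalM mpolyCM.
  rewrite (_ : _ * p = g1 * ((g2 - (g2.@[a])%:MP) * p) + (g2.@[a])%:MP * ((g1 - (g1.@[a])%:MP) * p)).
    by apply: annihD; apply: annihMl.
  by ring.
have EX i : E 'X_i by rewrite /E mevalXU.
have E1 : E 1 by rewrite /E meval1 subrr mul0r; exact: annih0.
elim/mpolyind: g => [|b x g _ _ IH]; first by rewrite meval0 mpolyC0 subr0 mul0r; exact: annih0.
rewrite mevalD mpolyCD opprD addrACA mulrDl; apply: annihD => //.
rewrite mevalZ mpolyCM -mul_mpolyC -mulrBr -mulrA; apply: annihMl.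
rewrite mpolyXE_id -/(E _); apply: (big_ind E) => // i _.
by elim: (x i) => [|k IHk]; rewrite ?expr0 // exprS; apply: EM.
Qed.

(** The degree is at most [m * e], so only the monomial with all exponents [e] counts. Expanding the
    determinant, only the identity permutation produces it; [hme] ensures that the subtractions in
    the exponents are not truncated. *)
Lemma jac_Xprod_top : rho (jac * \prod_(i < m) 'X_i ^+ (2 * i).+1) = 1.
Proof.
have hdeg : dle (m * e) (jac * \prod_(i < m) 'X_i ^+ (2 * i).+1).
  pose d := (\sum_(i < m) (e.+1 - 2 * i.+1))%N.
  have -> : (m * e = d + \sum_(i < m) (2 * i).+1)%N.
    rewrite /d -big_split /= -[m in (m * e)%N]card_ord -sum_nat_const.
    by apply: eq_bigr => i _; have := ltn_ord i; lia.
  have hX (i : 'I_m) k : dle k ('X_i ^+ k : {mpoly K[m]}).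
    by have := @dleXn K m _ k _ (@dleX K m U_(i)%MM); rewrite mdeg1 muln1.
  apply: dleM; last by apply: dle_prod => i.
  rewrite /jac /determinant; apply: dle_sum => s _.
  rewrite mulr_sign; case: (odd_perm s); first apply: dleN.
    rewrite /d (reindex_perm s); apply: dle_prod => i; rewrite mxE; exact: hX.
  rewrite /d (reindex_perm s); apply: dle_prod => i; rewrite mxE; exact: hX.
rewrite rho_top //.
rewrite /jac /determinant mulr_suml raddf_sum (bigD1 1%g) //= [X in _ + X]big1 ?addr0 => [|s s1].
  rewrite odd_perm1 expr0 mul1r -big_split /=.
  rewrite (eq_bigr (fun i : 'I_m => 'X_i ^+ e)) => [|i _]; last first.
    by rewrite !mxE perm1 -exprD; congr (_ ^+ _); have := ltn_ord i; lia.
  rewrite (_ : \prod_(i < m) 'X_i ^+ e = 'X_[[multinom e | i < m]]); last first.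
    by rewrite mpolyXE_id; apply: eq_bigr => i _; rewrite mnmE.
  by rewrite mcoeffX eqxx.
rewrite -mulrA -big_split /=.
rewrite (eq_bigr (fun i : 'I_m => 'X_i ^+ [multinom (e.+1 - 2 * (s i).+1 + (2 * i).+1)%N | i < m] i)) => [|i _]; last first.
  by rewrite !mxE -exprD mnmE.
rewrite -mpolyXE_id mulr_sign.
suff h : 'X_[[multinom (e.+1 - 2 * (s i).+1 + (2 * i).+1)%N | i < m]]@_[multinom e | i < m] = 0 :> K.
  by case: (odd_perm s); rewrite ?mcoeffN h ?oppr0.
rewrite mcoeffX; case: eqP => // /mnmP hs; case/eqP: s1; apply/permP => i; rewrite perm1.
by apply: val_inj; have := hs i; rewrite !mnmE /=; have := ltn_ord (s i); lia.
Qed.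

(* Otherwise all monomials of large degree annihilate [jac]; replacing the variables by the [w k],
   a monomial of degree > m has a factor [w k ^+ 2], which by [hFw] is of order 3 modulo the [F j],
   so that by descending induction all monomials of degree > m annihilate [jac], against
   [jac_Xprod_top]. *)
Lemma not_all_nilpotent : exists i, forall k, ~ annih ('X_i ^+ k * jac).
Proof.
apply: boolp.contrapT => hno.
have hnil i : exists k, annih ('X_i ^+ k * jac).
  by apply: boolp.contrapT => h; apply: hno; exists i => k hk; apply: h; exists k.
have [k hk] := fin_all_exists hnil.
pose I p := annih (p * jac).
have mon_dge n : (forall a, (n <= mdeg a)%N -> I 'X_[a]) -> forall p, dge n p -> I p.
  move=> h p hp; rewrite /I {1}[p]mpolyE big_seq mulr_suml; apply: annih_sum => a.
  rewrite mcoeff_msupp -scalerAl => pa; apply: annihZ; apply: h.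
  by rewrite leqNgt; apply: contra pa => /hp ->.
have top : forall p, dge (\sum_i k i).+1 p -> I p.
  apply: mon_dge => a ha.
  have [i hi] : exists i, (k i <= a i)%N.
    apply: boolp.contrapT => h; suff : (mdeg a <= \sum_i k i)%N by lia.
    by rewrite mdegE; apply: leq_sum => i _; case: leqP => // hi; case: h; exists i; exact: ltnW.
  have -> : a = (a - U_(i) *+ k i + U_(i) *+ k i)%MM.
    rewrite submK //; apply/mnm_lepP => j; rewrite mulmnE mnm1E.
    by case: eqP => [<-|]; rewrite ?mul1n ?mul0n.
  by rewrite /I mpolyXD -mpolyXn -mulrA; apply: annihMl.
have down n : (m < n)%N -> (forall p, dge n.+1 p -> I p) -> forall p, dge n p -> I p.
  move=> mn IH; apply: mon_dge => a; rewrite leq_eqVlt => /orP[/eqP|]; last first.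
    by move=> ha; apply: IH; apply: dgeW (@dgeX _ _ a).
  move=> na.
  suff gen r : forall a b : 'X_{1..m}, mdeg a = r -> (mdeg b + r = n)%N ->
      I ('X_[a] * \prod_i w i ^+ b i).
    have := gen n a 0%MM; rewrite mdeg0 add0n na => /(_ erefl erefl).
    by rewrite big1 ?mulr1 // => i _; rewrite mnm0E expr0.
  elim: r => [|r IHr] {a na} a b.
    move/eqP; rewrite mdeg_eq0 addn0 => /eqP -> hb; rewrite mpolyX0 mul1r.
    have [i hi] : exists i, (1 < b i)%N.
      apply: boolp.contrapT => h; suff : (mdeg b <= m)%N by lia.
      rewrite mdegE -[m in (_ <= m)%N]card_ord -sum1_card; apply: leq_sum => i _.
      by case: leqP => // hi; case: h; exists i.
    have [l hl] := hFw i.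
    rewrite (bigD1 i) //= -(subnK hi) exprD.
    set r3 := _ - _ in hl.
    have -> : w i ^+ 2 = \sum_j l j *: F j - r3 by rewrite /r3 opprB addrC subrK.
    set g := \prod_(_ < m | _) _.
    rewrite (_ : _ * g = (\sum_j l j *: F j) * (w i ^+ (b i - 2) * g) - r3 * (w i ^+ (b i - 2) * g)); last by ring.
    rewrite /I mulrBl; apply: annihD.
      rewrite -mulrA mulr_suml; apply: annih_sum => j _.
      by rewrite -scalerAl mulrC -mulrA; apply: annihZ; apply: annihMl; exact: annih_jacF.
    apply: annihN; apply: IH.
    have -> : n.+1 = (3 + (n - 2))%N by clear -mn hm; lia.
    apply: dgeM => //.
    have hwk (j : 'I_m) t : dge t (w j ^+ t).
      elim: t => [|t IHt]; first by [].
      by rewrite exprS; exact: (dgeM (hw1 j) IHt).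
    rewrite (_ : (n - 2 = b i - 2 + \sum_(j < m | j != i) b j)%N); last first.
      by move: hb; rewrite mdegE (bigD1 i) //= => <-; rewrite addnBAC.
    apply: dgeM => //.
    by rewrite /g; elim/big_rec2: _ => // j y z _ hy; exact: dgeM.
  move=> ha hb.
  have [i hi] : exists i, a i != 0%N.
    apply: boolp.contrapT => h; move: ha; rewrite mdegE big1 // => i _.
    by apply/eqP; apply: boolp.contrapT => /negP hi; apply: h; exists i.
  have ea : a = (a - U_(i) + U_(i))%MM by rewrite submK // lep1mP.
  have ha' : mdeg (a - U_(i))%MM = r.
    by apply/eqP; rewrite -eqSS -ha {2}ea mdegD mdeg1 addn1.
  have -> : 'X_[a] * \prod_i w i ^+ b i = \sum_j c i j *: ('X_[a - U_(i)] * (w j * \prod_i w i ^+ b i)).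
    rewrite {1}ea mpolyXD hXw -mulrA mulr_suml mulr_sumr; apply: eq_bigr => j _.
    by rewrite -scalerAl -scalerAr.
  rewrite /I mulr_suml; apply: annih_sum => j _.
  rewrite -scalerAl; apply: annihZ.
  have := IHr (a - U_(i))%MM (b + U_(j))%MM ha'; rewrite mdegD mdeg1 -addnA add1n => /(_ hb).
  rewrite (_ : \prod_i0 w i0 ^+ (b + U_(j))%MM i0 = w j * \prod_i w i ^+ b i); last first.
    rewrite (bigD1 j) //= [in RHS](bigD1 j) //= mnmDE mnm1E eqxx addn1 exprS -mulrA.
    congr (_ * (_ * _)); apply: eq_bigr => i' ji.
    by rewrite mnmDE mnm1E eq_sym (negPf ji) addn0.
  by [].
have low n : (m < n)%N -> forall p, dge n p -> I p.
  move=> mn; suff h t : forall n, (m < n)%N -> (\sum_i k i < n + t)%N -> forall p, dge n p -> I p.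
    by apply: (h (\sum_i k i).+1) => //; lia.
  elim: t => [|t IHt] n' hn' hs p hp.
    by apply: top; apply: dgeW hp; rewrite addn0 in hs.
  by apply: (down n') => //; apply: IHt; lia.
have : rho (jac * \prod_(i < m) 'X_i ^+ (2 * i).+1) = 0.
  rewrite mulrC -[X in rho X]mulr1; apply: (low m.+1) => //.
  have hX (i : 'I_m) t : dge t ('X_i ^+ t : {mpoly K[m]}).
    by rewrite mpolyXn; have := @dgeX K m (U_(i) *+ t)%MM; rewrite mdegMn mdeg1 mul1n.
  apply: (@dgeW _ _ (\sum_(i < m) (2 * i).+1)%N); last by apply: dge_prod => i.
  (* The sum of the first [m] odd numbers; it is at least [m.+1] because of [1 < m]. *)
  have : (\sum_(i < m) (2 * i).+1 = m * m)%N.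
    elim: (m) => [|t IHt]; first by rewrite big_ord0.
    by rewrite big_ord_recr /= IHt; lia.
  by move=> ->; nia.
by rewrite jac_Xprod_top => /eqP; rewrite oner_eq0.
Qed.

(** Take a multiple of [jac] that is nonzero in the quotient and a common eigenvector of the
    variables, with a nonzero eigenvalue for one of them. Each [F j] acts on it by its value at the
    point of eigenvalues, and also by 0, since [F j] kills [jac]. *)
Theorem common_zero : exists a : 'I_m -> K, (exists i, a i != 0) /\ forall j, (F j).@[a] = 0.
Proof.
have [i0 hi0] := not_all_nilpotent.
have [s hs] := annih_roots i0.
have [r [h [r0 hr hh]]] := annih_split_neq0 (annihMr jac hs) hi0.
have [h' [a [ha1 ha2]]] := common_eigen (enum 'I_m) hh.
have ha : eigen (h' * (h * jac)) a by move=> i; apply: ha2; rewrite mem_enum.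
have ann0 x : annih (x%:MP * (h' * (h * jac))) -> x = 0.
  move=> hx; apply/eqP; apply: contra_notT ha1 => x0.
  by have := annihZ x^-1 hx; rewrite mul_mpolyC scalerA mulVf // scale1r.
exists a; split=> [|j].
  exists i0; suff -> : a i0 = r by [].
  apply/eqP; rewrite -subr_eq0; apply/eqP; apply: ann0.
  have h1 : annih (('X_i0 - r%:MP) * (h' * (h * jac))) by rewrite mulrCA; apply: annihMl.
  have := annihD h1 (annihN (ha i0)); rewrite -mulrBl opprB addrC addrA subrK.
  by rewrite mpolyCB.
apply: ann0.
have h1 : annih (F j * (h' * (h * jac))).
  by rewrite mulrC -!mulrA; do 2!apply: annihMl; exact: annih_jacF.
have := annihD h1 (annihN (eigen_eval (F j) ha)).
by rewrite -mulrBl opprB addrC subrK.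
Qed.
End CommonZero.

(** * Determinants of periodic Jacobi matrices *)

Lemma ordSE q (a : 'I_q) : ordS a = (if a.+1 == q then 0 else a.+1)%N :> nat.
Proof.
by rewrite /=; have := ltn_ord a; case: eqP => [->|h] ha; rewrite ?modnn // modn_small //; lia.
Qed.

Section PeriodicJacobi.
Variables (A : comNzRingType) (q : nat).
Implicit Types (u : 'I_q -> A) (x y : A).

(** With [u a = 'X - v a] this is the characteristic matrix of the potential [v] on a cycle, where
    [x] and [y] weight the forward and the backward hops. *)
Definition perM u x y : 'M[A]_q :=
  \matrix_(a, b) (u a *+ (a == b) - (x *+ (b == ordS a) + y *+ (a == ordS b))).

Hypothesis q2 : (1 < q)%N.

Lemma ordS_neq (a : 'I_q) : (a == ordS a) = false.
Proof. by apply/negP => /eqP/(congr1 (@nat_of_ord q)); rewrite ordSE; case: eqP; lia. Qed.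

Lemma perM_diag u x y a : perM u x y a a = u a.
Proof. by rewrite mxE eqxx ordS_neq !mulr0n addr0 subr0. Qed.

Lemma perM_offdiag u u' x y a b : a != b -> perM u x y a b = perM u' x y a b.
Proof. by move=> /negPf ab; rewrite !mxE ab !mulr0n. Qed.

(** Without the site [o] the cycle is a path, on which the weights can be conjugated away: the
    exponent of [x] is the distance from [o] along the cycle. *)
Lemma perM_gauge u x y (o a b : 'I_q) : x * y = 1 -> a != o -> b != o ->
  perM u x y a b * x ^+ ((a + (q - o)) %% q) = perM u 1 1 a b * x ^+ ((b + (q - o)) %% q).
Proof.
move=> xy ao bo; have [<-|ab] := eqVneq a b; first by rewrite !perM_diag.
have gE (c : 'I_q) : ((c + (q - o)) %% q = if c < o then c + (q - o) else c - o)%N.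
  have := ltn_ord c; have := ltn_ord o => oq cq.
  case: ltnP => h; first by rewrite modn_small; lia.
  by rewrite (_ : c + (q - o) = c - o + q)%N ?modnDr ?modn_small; lia.
have gS (c : 'I_q) : ordS c != o -> ((ordS c + (q - o)) %% q = ((c + (q - o)) %% q).+1)%N.
  rewrite -(inj_eq (@ord_inj q)) !gE ordSE; have := ltn_ord c; have := ltn_ord o => oq cq.
  by repeat case: ifP; lia.
rewrite !mxE (negPf ab) !mulr0n !sub0r !mulNr !mulrDl; congr (- (_ + _)).
  case: eqP => [e|_]; last by rewrite !mulr0n !mul0r.
  by rewrite !mulr1n mul1r e gS -?e // exprS.
case: eqP => [e|_]; last by rewrite !mulr0n !mul0r.
by rewrite !mulr1n mul1r e gS -?e // exprS mulrA [y * x]mulrC xy mul1r.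
Qed.

(* Permutations with a fixed point have winding number zero around the cycle, so
   the twist [x] cancels; permutations without fixed points do not see [u]. *)
Lemma det_perM_twist u u' x y : x * y = 1 ->
  \det (perM u x y) - \det (perM u' x y) = \det (perM u 1 1) - \det (perM u' 1 1).
Proof.
move=> xy; rewrite /determinant -!sumrB; apply: eq_bigr => s _; rewrite -!mulrBr; congr (_ * _).
have [/existsP|] := boolP [exists a, s a == a]; last first.
  rewrite negb_exists => /forallP hs.
  have h u1 x1 y1 : \prod_i perM u1 x1 y1 i (s i) = \prod_i perM u x1 y1 i (s i).
    by apply: eq_bigr => i _; apply: perM_offdiag; rewrite eq_sym.
  by rewrite (h u') (h u' 1 1) !subrr.
case=> o /eqP so.
suff h u1 : \prod_i perM u1 x y i (s i) = \prod_i perM u1 1 1 i (s i) by rewrite !h.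
rewrite (bigD1 o) //= [in RHS](bigD1 o) //= so !perM_diag; congr (_ * _).
(* [A] is only a ring: the product of the [g i] is cancelled at the end by its explicit inverse, the
   product of the [g' i]. *)
pose g (i : 'I_q) := x ^+ ((i + (q - o)) %% q).
pose g' (i : 'I_q) := y ^+ ((i + (q - o)) %% q).
have key : (\prod_(i | i != o) perM u1 x y i (s i)) * \prod_(i | i != o) g i =
           (\prod_(i | i != o) perM u1 1 1 i (s i)) * \prod_(i | i != o) g i.
  have gs : \prod_(i | i != o) g i = \prod_(i | i != o) g (s i).
    by rewrite (reindex_inj (@perm_inj _ s)); apply: eq_bigl => i; rewrite -{1}so (inj_eq perm_inj).
  rewrite [in RHS]gs.
  rewrite -!big_split /=; apply: eq_bigr => i io; apply: perM_gauge => //.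
  by rewrite -{1}so (inj_eq perm_inj).
have gg : (\prod_(i | i != o) g i) * (\prod_(i | i != o) g' i) = 1.
  by rewrite -big_split big1 //= => i _; rewrite -exprMn xy expr1n.
by have := congr1 (fun z => z * \prod_(i | i != o) g' i) key; rewrite -!mulrA gg !mulr1.
Qed.

(** Reversing the cycle interchanges forward and backward hops. *)
Lemma det_perM_rev u x y : \det (perM (u \o @rev_ord q) x y) = \det (perM u y x).
Proof.
have revS (a b : 'I_q) : (rev_ord b == ordS (rev_ord a)) = (a == ordS b).
  have := ltn_ord a; have := ltn_ord b => hb ha; rewrite -!(inj_eq (@ord_inj q)).
  rewrite (ordSE (rev_ord a)) (ordSE b) /=.
  by have [h1|h1] := eqVneq (q - a.+1).+1 q; have [h2|h2] := eqVneq b.+1 q; lia.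
rewrite -det_tr.
pose r := perm (@rev_ord_inj q).
have -> : (perM (u \o @rev_ord q) x y)^T = row_perm r (col_perm r (perM u y x)^T).
  apply/matrixP => a b; rewrite !mxE !permE /= (inj_eq rev_ord_inj) !revS.
  by rewrite [X in _ - X]addrC.
rewrite row_permE col_permE !det_mulmx !det_perm det_tr odd_permV.
by rewrite mulrCA -signr_addb addbb mulr1.
Qed.

Lemma det_perM_opp u x y : \det (perM (fun a => - u a) (- x) (- y)) = (-1) ^+ q * \det (perM u x y).
Proof.
rewrite -detZ; congr (\det _); apply/matrixP => a b.
by rewrite !mxE !mulNrn mulN1r !opprD !opprK.
Qed.
End PeriodicJacobi.

Lemma map_perM (A B : comNzRingType) (f : {rmorphism A -> B}) q (u : 'I_q -> A) x y :
  map_mx f (perM u x y) = perM (f \o u) (f x) (f y).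
Proof. by apply/matrixP => a b; rewrite !mxE rmorphB rmorphD !rmorphMn. Qed.

Lemma size_monicB (A : nzRingType) n (p1 p2 : {poly A}) : p1 \is monic -> p2 \is monic ->
  size p1 = n.+1 -> size p2 = n.+1 -> (size (p1 - p2)%R <= n)%N.
Proof.
move=> /monicP m1 /monicP m2 s1 s2; apply/leq_sizeP => k; rewrite leq_eqVlt coefB => /orP[/eqP <-|hk].
  by move: m1 m2; rewrite !lead_coefE s1 s2 => -> ->; rewrite subrr.
by rewrite !nth_default ?subrr ?s1 ?s2.
Qed.

(** * Antisymmetric potentials on a cycle *)

Section Antisymmetric.
Variables (e : nat).
Local Notation q := e.+1.
Local Notation m := (q./2).

(** The default 0 concerns only the middle site of an odd cycle, which is its own mirror image. *)
Definition asym (S : zmodType) (t : 'I_m -> S) (a : 'I_q) : S :=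
  if insub (a : nat) is Some i then t i
  else if insub (rev_ord a : nat) is Some i then - t i else 0.

Lemma asym_rev (S : zmodType) (t : 'I_m -> S) a : asym t (rev_ord a) = - asym t a.
Proof.
rewrite /asym rev_ordK; case: insubP => [i hi ei|hi]; case: insubP => [j hj ej|hj]; rewrite ?opprK ?oppr0 //.
by move: hi hj => /=; have := ltn_ord a; lia.
Qed.

Lemma half_le : (m <= q)%N. Proof. by lia. Qed.

Lemma asym_widen (S : zmodType) (t : 'I_m -> S) i : asym t (widen_ord half_le i) = t i.
Proof. by rewrite /asym /=; case: insubP => [j _ ej|]; [congr t; apply: val_inj|rewrite ltn_ord]. Qed.

Lemma raddf_asym (S S' : zmodType) (f : {additive S -> S'}) (t : 'I_m -> S) a :
  f (asym t a) = asym (f \o t) a.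
Proof. by rewrite /asym; case: insubP => [//|_]; case: insubP => [i|]; rewrite ?raddfN ?raddf0. Qed.

Lemma sum_asym (S : zmodType) (t : 'I_m -> S) : (\sum_a asym t a) *+ 2 = 0.
Proof.
rewrite mulr2n {1}(reindex_inj (@rev_ord_inj q)) /= -big_split big1 //= => a _.
by rewrite asym_rev addNr.
Qed.
End Antisymmetric.

Section Isospectral1D.
Variables (C : numClosedFieldType) (e : nat).
Local Notation q := e.+1.
Local Notation m := (q./2).
Hypothesis q4 : (3 < q)%N.
Local Notation B := {mpoly C[m]}.

Let q2 : (1 < q)%N. Proof. by lia. Qed.

Definition gv (a : 'I_q) : B := asym (fun i => 'X_i) a.
(** Perturbed minus free characteristic polynomial for the generic antisymmetric potential. The
    weights 1 stand for any twist, by [gdiffE]. *)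
Definition gdiff : {poly B} := \det (perM (fun a => 'X - (gv a)%:P) 1 1) - \det (perM (fun _ : 'I_q => 'X) 1 1).

Lemma gdiffE x y : x * y = 1 ->
  gdiff = \det (perM (fun a => 'X - (gv a)%:P) x y) - \det (perM (fun _ : 'I_q => 'X) x y).
Proof. by move=> xy; rewrite /gdiff -(det_perM_twist q2 _ _ xy). Qed.

(** Reversal turns [gv] into its opposite; changing the sign of the whole matrix then undoes the
    substitution, at the price of the twist -1, which [gdiff] does not see. *)
Lemma gdiff_comp : gdiff \Po (- 'X) = (-1) ^+ q * gdiff.
Proof.
have hc (u : 'I_q -> {poly B}) : \det (perM u 1 1) \Po (- 'X) = \det (perM (fun a => u a \Po - 'X) 1 1).
  by rewrite -[LHS](det_map_mx (comp_poly (- 'X))) map_perM /= rmorph1.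
rewrite {1}/gdiff raddfB /= !hc (@gdiffE (-1) (-1)) ?mulrNN ?mulr1 //.
rewrite mulrBr -!det_perM_opp !opprK; congr (_ - _).
  rewrite -(det_perM_rev q2); congr (\det _); apply/matrixP => a b; rewrite !mxE /=.
  congr (_ *+ _ - _); by rewrite comp_polyB comp_polyX comp_polyC /gv asym_rev polyCN opprB opprK addrC.
by congr (\det _); apply/matrixP => a b; rewrite !mxE comp_polyX.
Qed.

Lemma gdiff_size : (size gdiff <= q)%N.
Proof.
pose M (u : 'I_q -> B) : 'M[B]_q := \matrix_(a, b) (u a *+ (a == b) + ((b == ordS a)%:R + (a == ordS b)%:R)).
have hM u : \det (perM (fun a => 'X - (u a)%:P) 1 1) = char_poly (M u).
  congr (\det _); apply/matrixP => a b; rewrite !mxE rmorphD rmorphMn rmorphD /= !rmorph_nat.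
  by rewrite mulrnBl [in RHS]opprD addrA.
have -> : gdiff = char_poly (M gv) - char_poly (M (fun=> 0)).
  rewrite -!hM /gdiff; congr (_ - \det _); apply/matrixP => a b; rewrite !mxE.
  by rewrite polyC0 subr0.
by apply: size_monicB; rewrite ?char_poly_monic ?size_char_poly.
Qed.

(** By degree and parity, no other coefficient of [gdiff] can be nonzero. The sign makes their
    combinations equal to free minus perturbed determinant, the form required by [hF] in
    [common_zero]. *)
Definition gF (j : 'I_m) : B := - gdiff`_(q - 2 * j.+1).

Lemma gdiff_parity k : odd (q + k) -> gdiff`_k = 0.
Proof.
move=> hk.
have : (gdiff \Po (- 'X))`_k = (-1) ^+ k * gdiff`_k.
  have -> : gdiff \Po (- 'X) = \poly_(i < size gdiff) ((-1) ^+ i * gdiff`_i).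
    rewrite comp_polyE poly_def; apply: eq_bigr => i _.
    by rewrite -[- 'X]mulN1r exprMn -(rmorphN1 polyC) -rmorphXn mul_polyC scalerA mulrC.
  by rewrite coef_poly; case: ltnP => // h; rewrite nth_default ?mulr0.
rewrite gdiff_comp -(rmorphN1 polyC) -rmorphXn coefCM => h.
have : (-1) ^+ k * ((-1) ^+ q * gdiff`_k) = gdiff`_k by rewrite h mulrA -exprMn mulrNN mulr1 expr1n mul1r.
rewrite mulrA -exprD addnC -signr_odd hk expr1 mulN1r => /esym/eqP; rewrite -addr_eq0 -mulr2n.
rewrite -scaler_nat scaler_eq0 pnatr_eq0 => /= /eqP //.
Qed.

Lemma gdiff_expand : gdiff = - \sum_(j < m) gF j *: 'X^(q - 2 * j.+1).
Proof.
apply/polyP => k; rewrite coefN coef_sum.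
have cf j : (gF j *: 'X^(q - 2 * j.+1))`_k = gF j *+ (k == (q - 2 * j.+1)%N).
  by rewrite coefZ coefXn; case: eqP; rewrite ?mulr1 ?mulr0.
rewrite (eq_bigr _ (fun j _ => cf j)).
have [[j ej]|h] := boolp.EM (exists j : 'I_m, k = (q - 2 * j.+1)%N).
  rewrite (bigD1 j) // big1 ?addr0 => [|i ij].
    rewrite /= ej.
    by rewrite addr0 eqxx mulr1n /gF opprK.
  case: eqP => // ei; case/eqP: ij; apply: ord_inj.
  by have := ltn_ord i; have := ltn_ord j; lia.
rewrite big1 ?oppr0 => [|j _]; last by case: eqP => // ej; case: h; exists j.
have [hk|hk] := ltnP k q; last by rewrite nth_default // (leq_trans gdiff_size).
have [hp|hp] := boolP (odd (q + k)); first exact: gdiff_parity.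
have hj : ((q - k)./2.-1 < m)%N by lia.
by case: h; exists (Ordinal hj) => /=; lia.
Qed.
End Isospectral1D.

(** * Roots of unity, the discrete Fourier transform, and estimates of determinants *)

Lemma prim_root_exists (C : numClosedFieldType) n : (0 < n)%N -> exists z : C, n.-primitive_root z.
Proof.
move=> n0; have [r er] := closed_field_poly_normal ('X^n - 1 : {poly C}).
rewrite lead_coefXnsubC // scale1r in er.
have ur : uniq r.
  rewrite -separable_prod_XsubC -er unlock; apply/Bezout_eq1_coprimepP.
  (* Bezout relation: the derivative of ['X^n - 1], multiplied by ['X] and divided by [n], is
     ['X^n]. *)
  exists (-1, (n%:R^-1)%:P * 'X) => /=; rewrite derivB derivXn derivC subr0 mulN1r opprB.
  rewrite -mulrA mulrnAr -exprS prednK // mulrnAr -mulrnAl -polyCMn -(mulr_natr n%:R^-1) mulVf ?mul1r ?subrK //.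
  by rewrite pnatr_eq0 -lt0n.
have sr : size r = n by apply: succn_inj; rewrite -(size_XnsubC (1 : C) n0) polyC1 er size_prod_XsubC.
have /hasP[z _ hz] : has n.-primitive_root r; last by exists z.
apply: has_prim_root; rewrite ?sr //; apply/allP => z zr.
by rewrite /root_of_unity er root_prod_XsubC.
Qed.

Lemma prim_sum_expr (C : fieldType) n (z : C) k : n.-primitive_root z ->
  \sum_(a < n) z ^+ (a * k) = (n%:R) *+ (n %| k)%N.
Proof.
move=> hz; have [/dvdnP[l ->]|hk] := boolP (n %| k)%N.
  rewrite (eq_bigr (fun=> 1)) ?sumr_const ?card_ord // => a _.
  by rewrite mulnA [(_ * n)%N]mulnC exprM (prim_expr_order hz) expr1n.
have h1 : z ^+ k - 1 != 0 by rewrite subr_eq0 -(prim_order_dvd hz).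
apply/eqP; rewrite -(mulrI_eq0 _ (mulfI h1)) (eq_bigr (fun a : 'I_n => (z ^+ k) ^+ a)) => [|a _].
  by rewrite -subrX1 -exprM mulnC exprM (prim_expr_order hz) expr1n subrr.
by rewrite mulnC exprM.
Qed.

Section Fourier.
Variables (C : fieldType) (n q : nat) (om : C).
Hypothesis q2 : (1 < q)%N.
Hypothesis om_prim : q.-primitive_root om.
Local Notation B := {mpoly C[n]}.

(** The matrix of multiplication by [v] in the basis of characters; an entry depends only on
    [l - l'] modulo [q]. *)
Definition four (v : 'I_q -> B) (l' l : 'I_q) : B :=
  \sum_(a < q) (om ^+ (a * l) * om ^- (a * l') / q%:R) *: v a.

Lemma four_orth (l' l : 'I_q) : \sum_(a < q) om ^- (a * l') / q%:R * om ^+ (a * l) = (l' == l)%:R.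
Proof.
have q0 : q%:R != 0 :> C by rewrite (prim_root_natf_neq0 om_prim).
have omk0 k : om ^+ k != 0.
  by rewrite expf_neq0 // (prim_root_eq0 om_prim) -lt0n; exact: ltnW.
have : \sum_(a < q) om ^+ (a * (l + (q - l'))) = q%:R *+ (l' == l).
  rewrite (prim_sum_expr _ om_prim); congr (_ *+ nat_of_bool _).
  have := ltn_ord l; have := ltn_ord l' => hl' hl.
  apply/idP/eqP => [/dvdnP[k hk]|->]; last by rewrite subnKC // ltnW.
  apply: val_inj => /=; have : (k = 1)%N by nia.
  by move=> k1; move: hk; rewrite k1; lia.
move=> h; apply: (mulfI q0); rewrite mulr_natr -h mulr_sumr; apply: eq_bigr => a _.
have -> : om ^+ (a * (l + (q - l'))) = om ^+ (a * l) * om ^- (a * l').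
  apply: (mulIf (omk0 (a * l')%N)); rewrite -exprD divfK //.
  rewrite -mulnDr -addnA subnK; last exact/ltnW/ltn_ord.
  by rewrite mulnDr exprD [(a * q)%N]mulnC (exprM om q) (prim_expr_order om_prim) expr1n mulr1.
by rewrite mulrA [q%:R * _]mulrC divfK // mulrC.
Qed.

(** The characters diagonalize the cyclic shift, so after conjugation the hopping is diagonal and
    the potential becomes a convolution. *)
Lemma det_perM_fourier (v : 'I_q -> B) (mu x y : C) : x * y = 1 ->
  \det (perM (fun a => mu%:MP - v a) x%:MP y%:MP) =
  \det (\matrix_(l', l) ((mu - x * om ^+ l - y * om ^- l)%:MP *+ (l' == l) - four v l' l)).
Proof.
move=> xy; have q0 : q%:R != 0 :> C by rewrite (prim_root_natf_neq0 om_prim).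
have om0 : om != 0 by rewrite (prim_root_eq0 om_prim) -lt0n; exact: ltnW.
have omk0 k : om ^+ k != 0 by rewrite expf_neq0.
pose E : 'M[B]_q := \matrix_(a < q, l < q) (om ^+ (a * l))%:MP.
pose E' : 'M[B]_q := \matrix_(l' < q, a < q) (om ^- (a * l') / q%:R)%:MP.
have EE : E' *m E = 1%:M.
  apply/matrixP => l' l; rewrite !mxE -(rmorph_nat (@mpolyC n C)) -four_orth rmorph_sum.
  by apply: eq_bigr => a _; rewrite !mxE -rmorphM.
set M := perM _ _ _.
have -> : \det M = \det (E' *m (M *m E)).
  by rewrite !det_mulmx mulrCA -[X in _ = _ * X]det_mulmx EE det1 mulr1.
congr (\det _).
have ES (a l : 'I_q) : om ^+ (ordS a * l) = om ^+ l * om ^+ (a * l).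
  by rewrite exprM -[ordS a : nat]/(a.+1 %% q)%N (prim_expr_mod om_prim) -exprM mulSn exprD.
have ME a l : (M *m E) a l = ((mu - x * om ^+ l - y * om ^- l)%:MP - v a) * E a l.
  rewrite mxE (eq_bigr (fun b => (mu%:MP - v a) *+ (b == a) * E b l
      - (x%:MP *+ (b == ordS a) * E b l + y%:MP *+ (b == ord_pred a) * E b l))) => [|b _]; last first.
    have -> : (b == ord_pred a) = (a == ordS b).
      by rewrite -(inj_eq (can_inj (@ordSK q))) ord_predK eq_sym.
    by rewrite !mxE mulrBl mulrDl [a == b]eq_sym.
  have one (f : B) (i : 'I_q) : \sum_b f *+ (b == i) * E b l = f * E i l.
    rewrite (bigD1 i) //= eqxx mulr1n big1 ?addr0 // => b /negPf ->.
    by rewrite mulr0n mul0r.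
  rewrite sumrB big_split /= !one.
  have -> : E (ordS a) l = (om ^+ l)%:MP * E a l by rewrite !mxE ES mpolyCM.
  have -> : E (ord_pred a) l = (om ^- l)%:MP * E a l.
    by rewrite !mxE -[in RHS](ord_predK a) ES -mpolyCM mulKf.
  by rewrite !mpolyCB !mpolyCM; ring.
apply/matrixP => l' l; rewrite mxE (eq_bigr _ (fun a _ => congr2 *%R erefl (ME a l))) mxE.
rewrite (eq_bigr (fun a => (mu - x * om ^+ l - y * om ^- l)%:MP * (E' l' a * E a l)
   - (om ^+ (a * l) * om ^- (a * l') / q%:R) *: v a)) => [|a _]; last first.
  by rewrite !mxE -mul_mpolyC !mpolyCM; ring.
rewrite sumrB; congr (_ - _); rewrite -mulr_sumr.
have /matrixP/(_ l' l) := EE; rewrite !mxE => ->.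
by rewrite mulr_natr.
Qed.
End Fourier.

(** The diagonal entries at [i] and [j] have no constant term. The transposition of [i] and [j]
    gives the quadratic term and the identity gives 0; any other permutation moves some third index
    [l], and its factors at [i], [j] and [l] all have order at least 1. *)
Lemma det_low_order (C : fieldType) n q (W : 'I_q -> 'I_q -> {mpoly C[n]}) (c : 'I_q -> C) i j :
  i != j -> c i = 0 -> c j = 0 -> (forall a b, dge 1 (W a b)) -> (forall a, W a a = 0) ->
  dge 3 (\det (\matrix_(a, b) ((c b)%:MP *+ (a == b) - W a b))
         + (\prod_(l | (l != i) && (l != j)) c l) *: (W i j * W j i)).
Proof.
move=> ij ci cj hW W0; set M := \matrix_(a, b) _.
have ent a b : (c b = 0) \/ (a != b) -> M a b = - W a b.
  rewrite mxE => -[->|/negPf ->]; last by rewrite mulr0n sub0r.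
  by rewrite mpolyC0 mul0rn sub0r.
rewrite /determinant (bigD1 (tperm i j)) //= odd_tperm ij expr1 mulN1r.
have -> : \prod_a M a (tperm i j a) =
    (\prod_(l | (l != i) && (l != j)) c l) *: (W i j * W j i).
  rewrite (bigD1 i) //= (bigD1 j) 1?eq_sym //= tpermL tpermR !ent; try by [right|right; rewrite eq_sym].
  rewrite mulrA mulrNN mulrC -mul_mpolyC rmorph_prod; congr (_ * _).
  apply: eq_bigr => l /andP[li lj]; rewrite tpermD 1?eq_sym // mxE eqxx W0 subr0 //.
rewrite addrAC addNr add0r; apply: dge_sum => s hs.
rewrite mulr_sign; suff h : dge 3 (\prod_a M a (s a)) by case: (odd_perm s) => //; exact: dgeN.
have [->|s1] := eqVneq s 1%g.
  by rewrite (bigD1 i) //= perm1 ent ?W0 ?oppr0 ?mul0r; [exact: dge0|left].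
have [l [li lj sl]] : exists l, [/\ l != i, l != j & s l != l].
  apply: boolp.contrapT => hno.
  have fix_ l : l != i -> l != j -> s l = l.
    by move=> li lj; apply/eqP/negPn/negP => sl; apply: hno; exists l.
  have si : s i \in [:: i; j].
    rewrite !inE; apply/negPn/negP; rewrite negb_or => /andP[h1 h2].
    by have /perm_inj h3 := fix_ _ h1 h2; rewrite h3 eqxx in h1.
  have sj : s j \in [:: i; j].
    rewrite !inE; apply/negPn/negP; rewrite negb_or => /andP[h1 h2].
    by have /perm_inj h3 := fix_ _ h1 h2; rewrite h3 eqxx in h2.
  have sij : s i != s j by rewrite (inj_eq perm_inj).
  move: si sj sij; rewrite !inE => /orP[]/eqP si /orP[]/eqP sj; rewrite si sj ?eqxx // => _.
    case/eqP: s1; apply/permP => a; rewrite perm1.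
    by have [->//|ai] := eqVneq a i; have [->//|aj] := eqVneq a j; apply: fix_.
  case/eqP: hs; apply/permP => a.
  by case: tpermP => [->|->|/eqP ai /eqP aj] //; apply: fix_.
rewrite (bigD1 i) //= (bigD1 j) 1?eq_sym //= (bigD1 l) ?li //=.
have h1 a : (c a = 0) \/ (s a != a) -> dge 1 (M a (s a)).
  move=> ha; rewrite ent; first exact: dgeN.
  by have [e|e] := eqVneq (s a) a; [left; rewrite e; case: ha => //; rewrite e eqxx|right].
apply: (@dgeM _ _ 1 2); first by apply: h1; left.
apply: (@dgeM _ _ 1 1); first by apply: h1; left.
by apply: (@dgeM _ _ 1 0) => //; apply: h1; right.
Qed.

(** A permutation other than the identity uses an off-diagonal entry, which is constant, and so
    loses at least one degree. *)
Lemma dle_det_perM (C : fieldType) n q (u : 'I_q -> {mpoly C[n]}) x y : (1 < q)%N ->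
  (forall a, dle 1 (u a)) -> dle 0 x -> dle 0 y -> dle q.-1 (\det (perM u x y) - \prod_a u a).
Proof.
move=> q2 hu hx hy; rewrite /determinant (bigD1 1%g) //= odd_perm1 expr0 mul1r.
have -> : \prod_a perM u x y a ((1%g : {perm 'I_q}) a) = \prod_a u a.
  by apply: eq_bigr => a _; rewrite perm1 perM_diag.
rewrite addrAC subrr add0r; apply: dle_sum => s s1.
rewrite mulr_sign; suff h : dle q.-1 (\prod_a perM u x y a (s a)) by case: (odd_perm s) => //; exact: dleN.
have [l sl] : exists l, s l != l.
  apply: boolp.contrapT => hno; case/eqP: s1; apply/permP => a; rewrite perm1.
  by apply/eqP/negPn/negP => sa; apply: hno; exists a.
have -> : q.-1 = (\sum_(a < q) (a != l))%N.
  rewrite (bigD1 l) //= eqxx add0n (eq_bigr (fun=> 1%N)) => [|a ->] //.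
  by rewrite sum1_card cardC1 card_ord.
apply: dle_prod => a; have [->|al] := eqVneq a l.
  rewrite mxE eq_sym (negPf sl) mulr0n sub0r; apply: dleN.
  by apply: dleD; case: (_ == _); rewrite ?mulr0n ?mulr1n //; exact: dle0.
rewrite mxE; apply: dleD; first by case: (_ == _); rewrite ?mulr0n ?mulr1n //; exact: dle0.
apply: dleN; apply: (@dleW _ _ 0) => //.
by apply: dleD; case: (_ == _); rewrite ?mulr0n ?mulr1n //; exact: dle0.
Qed.

(** * Existence on a cycle: the coefficients [gF] satisfy the hypotheses of [common_zero] *)

Section Existence1D.
Variables (C : numClosedFieldType) (e : nat).
Local Notation q := e.+1.
Local Notation m := (q./2).
Hypothesis q4 : (3 < q)%N.
Local Notation B := {mpoly C[m]}.
Local Notation gv := (@gv C e).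

Let q2 : (1 < q)%N. Proof. by lia. Qed.

Lemma gv_widen i : gv (widen_ord (@half_le e) i) = 'X_i.
Proof. exact: asym_widen. Qed.

Lemma gv_rev a : gv (rev_ord a) = - gv a.
Proof. exact: asym_rev. Qed.

Lemma meval_gv (t : 'I_m -> C) a : (gv a).@[t] = asym t a.
Proof.
rewrite /gv raddf_asym /asym; case: insubP => [i _ _|_]; first exact: mevalXU.
by case: insubP => [i _ _|_] //=; rewrite mevalXU.
Qed.

Lemma dle_gv a : dle 1 (gv a).
Proof.
rewrite /gv /asym; have hX (i : 'I_m) : dle 1 ('X_i : B).
  by have := @dleX C m U_(i)%MM; rewrite mdeg1.
by case: insubP => [//|_]; case: insubP => [i _ _|_]; [exact: dleN|exact: dle0].
Qed.

Lemma dge_gv a : dge 1 (gv a).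
Proof.
rewrite /gv /asym; have hX (i : 'I_m) : dge 1 ('X_i : B).
  by have := @dgeX C m U_(i)%MM; rewrite mdeg1.
by case: insubP => [//|_]; case: insubP => [i _ _|_]; [exact: dgeN|exact: dge0].
Qed.

Lemma gdiff_horner (b x y : B) : x * y = 1 ->
  (gdiff C e).[b] = \det (perM (fun a => b - gv a) x y) - \det (perM (fun _ : 'I_q => b) x y).
Proof.
move=> xy; rewrite (@gdiffE _ _ q4 x%:P y%:P) -?polyCM ?xy ?polyC1 //.
have hE u : (\det (perM u x%:P y%:P)).[b] = \det (perM (fun a => (u a).[b]) x y) :> B.
  rewrite -[LHS]/(horner_eval b _) -det_map_mx map_perM /= /horner_eval !hornerC.
  by congr (\det _); apply/matrixP => i j; rewrite !mxE.
rewrite hornerD hornerN !hE; congr (_ - _); congr (determinant _); apply/matrixP => i j; rewrite !mxE.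
  by rewrite hornerD hornerN hornerX hornerC.
by rewrite hornerX.
Qed.

Lemma sum_gF (b x y : B) : x * y = 1 ->
  \sum_(j < m) gF C j * b ^+ (q - 2 * j.+1) =
  \det (perM (fun _ : 'I_q => b) x y) - \det (perM (fun a => b - gv a) x y).
Proof.
move=> xy; rewrite -[RHS]opprB -gdiff_horner // gdiff_expand // hornerN opprK horner_sum.
by apply: eq_bigr => j _; rewrite hornerZ hornerXn.
Qed.

Definition gL i : B := 'X_i ^+ q - \sum_(j < m) gF C j * 'X_i ^+ (q - 2 * j.+1).

(** Put [b = 'X_i] in [sum_gF]. Since ['X_i] is an entry of [gv], the diagonal product of the
    perturbed matrix vanishes; that of the free matrix is ['X_i ^+ q]. Everything else has degree at
    most [e]. *)
Lemma dle_gL i : dle e (gL i).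
Proof.
have hX : dle 1 ('X_i : B) by have := @dleX C m U_(i)%MM; rewrite mdeg1.
have h1 : dle 0 (1 : B) by exact: dle1.
rewrite /gL (@sum_gF _ 1 1) ?mulr1 // opprB addrCA.
have -> : \det (perM (fun a => 'X_i - gv a) 1 1) =
   \det (perM (fun a => 'X_i - gv a) 1 1) - \prod_(a < q) ('X_i - gv a).
  rewrite [\prod_(a < q) _](bigD1 (widen_ord (@half_le e) i)) //=.
  by rewrite (gv_widen i) subrr mul0r subr0.
apply: dleD.
  by apply: (@dle_det_perM _ _ q) => // a; apply: dleD => //; apply: dleN; exact: dle_gv.
rewrite -opprB; apply: dleN.
have -> : 'X_i ^+ q = \prod_(a < q) 'X_i :> B by rewrite prodr_const card_ord.
exact: (@dle_det_perM _ _ q).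
Qed.

Variable th : C.
Hypothesis th_prim : (2 * q).-primitive_root th.
Let om := th ^+ 2.

Let om_prim : q.-primitive_root om.
Proof.
have := dvdn_prim_root th_prim (dvdn_mull 2 (dvdnn q)).
by rewrite mulnK.
Qed.

Let om0 k : om ^+ k != 0.
Proof. by rewrite expf_neq0 // (prim_root_eq0 om_prim). Qed.

(** Unnormalized Fourier coefficients of the generic potential. Those with [k] from 1 to [m] serve
    as the [w k] of [common_zero]. *)
Definition gw k : B := \sum_(b < q) om ^+ (b * k) *: gv b.

(** By antisymmetry, opposite frequencies carry the same coefficient up to a unit, so half of the
    frequencies suffice. *)
Lemma gw_flip k l : (k + l = q)%N -> gw l = - om ^+ k *: gw k.
Proof.
move=> kl; rewrite /gw (reindex_inj (@rev_ord_inj q)) /= scaler_sumr; apply: eq_bigr => b _.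
rewrite gv_rev scalerN scaleNr scalerA -exprD; congr (- (_ *: _)).
apply: (mulIf (om0 (b.+1 * l)%N)); rewrite -!exprD -mulnDl subnK //.
rewrite -mulSn -mulnDr kl [(b.+1 * q)%N]mulnC !exprM (prim_expr_order om_prim) !expr1n //.
Qed.

Lemma gw0 : gw 0 = 0.
Proof.
rewrite /gw (eq_bigr gv) => [|b _]; last by rewrite muln0 expr0 scale1r.
have := @sum_asym e B (fun i => 'X_i); rewrite -/gv -scaler_nat => /eqP.
by rewrite scaler_eq0 pnatr_eq0 => /= /eqP.
Qed.

Lemma gw_span l : (l < q)%N -> exists c : 'I_m -> C, gw l = \sum_k c k *: gw k.+1.
Proof.
move=> lq.
have one k (c : C) : (0 < k <= m)%N -> exists c' : 'I_m -> C, c *: gw k = \sum_k c' k *: gw k.+1.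
  move=> /andP[k0 km]; have km' : (k.-1 < m)%N by lia.
  exists (fun i => if i == Ordinal km' then c else 0).
  rewrite (bigD1 (Ordinal km')) // eqxx /= prednK // big1 ?addr0 // => i /negPf ->.
  by rewrite scale0r.
have [->|l0] := posnP l.
  by exists (fun=> 0); rewrite gw0 big1 // => i _; rewrite scale0r.
have [lm|lm] := leqP l m; first by have := one l 1; rewrite scale1r l0 lm => /(_ isT).
rewrite (@gw_flip (q - l) l); last by lia.
by apply: one; lia.
Qed.

Lemma gv_span a : exists c : 'I_m -> C, gv a = \sum_k c k *: gw k.+1.
Proof.
have q0 : q%:R != 0 :> C by rewrite pnatr_eq0.
have [c hc] := fin_all_exists (fun l : 'I_q => gw_span (ltn_ord l)).
exists (fun k => \sum_(l < q) om ^- (a * l) / q%:R * c l k).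
rewrite (eq_bigr (fun k => \sum_(l < q) (om ^- (a * l) / q%:R) *: (c l k *: gw k.+1))) => [|k _]; last first.
  by rewrite scaler_suml; apply: eq_bigr => l _; rewrite scalerA.
rewrite exchange_big /= (eq_bigr (fun l : 'I_q => (om ^- (a * l) / q%:R) *: gw l)) => [|l _]; last first.
  by rewrite hc scaler_sumr.
rewrite /gw (eq_bigr (fun l : 'I_q => \sum_(b < q) (om ^- (a * l) / q%:R * om ^+ (b * l)) *: gv b)) => [|l _]; last first.
  by rewrite scaler_sumr; apply: eq_bigr => b _; rewrite scalerA.
rewrite exchange_big /= (eq_bigr (fun b => (b == a)%:R *: gv b)) => [|b _]; last first.
  rewrite -scaler_suml; congr (_ *: _).
  rewrite eq_sym -(four_orth q2 om_prim); apply: eq_bigr => l _.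
  by rewrite [(a * l)%N]mulnC [(b * l)%N]mulnC.
rewrite (bigD1 a) //= eqxx scale1r big1 ?addr0 // => b /negPf ->.
by rewrite scale0r.
Qed.

(** Evaluate [sum_gF] at a double eigenvalue [mu] of a free operator. In the Fourier basis two
    diagonal entries vanish, and by [det_low_order] the determinant starts with the product of the
    two coefficients linking these modes, both multiples of [gw k.+1]. *)
Lemma gF_quadratic (k : 'I_m) :
  exists a : 'I_m -> C, dge 3 (\sum_j a j *: gF C j - gw k.+1 ^+ 2).
Proof.
have kq : (k.+1 < q)%N by have := ltn_ord k; lia.
have kq' : (q - k.+1 < q)%N by lia.
(* The twist is a square root of [om ^+ k.+1], whence the need for a root of unity of order [2 * q]:
   with it the modes [0] and [q - k.+1] have the same eigenvalue [z + z^-1]. *)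
pose z := th ^+ k.+1; pose i : 'I_q := ord0; pose j : 'I_q := Ordinal kq'.
have z0 : z != 0 by rewrite expf_neq0 // (prim_root_eq0 th_prim).
have zz : z ^+ 2 = om ^+ k.+1 by rewrite /z /om -!exprM mulnC.
have omV : om ^+ (q - k.+1) = om ^- k.+1.
  apply: (mulIf (om0 k.+1)); rewrite -exprD subnK; last by lia.
  by rewrite (prim_expr_order om_prim) mulVf.
pose mu := z + z^-1; pose c (l : 'I_q) := mu - z * om ^+ l - z^-1 * om ^- l.
have cE l : c l = (1 - om ^+ l) * (z - z^-1 * om ^- l).
  by rewrite /c /mu; field; rewrite z0 om0.
have ci : c i = 0 by rewrite cE expr0 subrr mul0r.
have cj : c j = 0.
  by rewrite cE omV invrK -zz expr2 mulKf // subrr mulr0.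
have c_neq0 l : l != i -> l != j -> c l != 0.
  move=> li lj; rewrite cE mulf_neq0 //.
    rewrite subr_eq0 eq_sym -(prim_order_dvd om_prim); apply: contra li => ql; apply/eqP/val_inj => /=.
    by have := ltn_ord l; case: (posnP l) => // l0; rewrite ltnNge dvdn_leq.
  rewrite subr_eq0; apply: contra lj => /eqP h; apply/eqP/val_inj => /=.
  have : om ^+ (k.+1 + l) == 1.
    by rewrite exprD -zz expr2 {1}h; apply/eqP; field; rewrite z0 om0.
  rewrite -(prim_order_dvd om_prim) => /dvdnP[t ht]; have := ltn_ord l => lq.
  have t1 : t = 1%N by nia.
  by move: ht; rewrite t1 mul1n => ht; rewrite -[nat_of_ord l](addKn k.+1) ht.
have ij : i != j.
  apply/eqP => /(congr1 (@nat_of_ord q)) h; have h' : (0 = q - k.+1)%N := h.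
  by move: kq; rewrite -subn_gt0 -h'.
have q0 : q%:R != 0 :> C by rewrite pnatr_eq0.
have four_gvE (l' l : 'I_q) : l' = i -> four om gv l' l = q%:R^-1 *: gw l.
  move=> ->; rewrite /four /gw scaler_sumr; apply: eq_bigr => a _.
  by rewrite muln0 expr0 invr1 mulr1 scalerA mulrC.
have fij : four om gv i j = q%:R^-1 *: gw (q - k.+1) by rewrite four_gvE.
have fji : four om gv j i = q%:R^-1 *: gw k.+1.
  rewrite /four /gw scaler_sumr; apply: eq_bigr => a _.
  rewrite muln0 expr0 mul1r scalerA; congr (_ *: _); rewrite mulrC; congr (_ * _).
  by rewrite mulnC exprM omV exprVn -exprM mulnC invrK.
have dge_four (v : 'I_q -> B) a b : (forall a, dge 1 (v a)) -> dge 1 (four om v a b).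
  by move=> hv; apply: dge_sum => l _; apply: dgeZ.
have four_diag (v : 'I_q -> B) a : \sum_b v b = 0 -> four om v a a = 0.
  move=> hv; rewrite /four (eq_bigr (fun b => q%:R^-1 *: v b)) => [|b _].
    by rewrite -scaler_sumr hv scaler0.
  by rewrite mulfV ?mul1r ?om0.
pose P := \prod_(l | (l != i) && (l != j)) c l.
have P0 : P != 0 by apply/prodf_neq0 => l /andP[]; exact: c_neq0.
have low (v : 'I_q -> B) : (forall a, dge 1 (v a)) -> \sum_b v b = 0 ->
    dge 3 (\det (perM (fun a => mu%:MP - v a) z%:MP (z^-1)%:MP) + P *: (four om v i j * four om v j i)).
  move=> hv sv; rewrite (det_perM_fourier q2 om_prim) ?mulfV //.
  apply: det_low_order => // [a b|a]; first exact: dge_four.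
  exact: four_diag.
have sgv : \sum_b gv b = 0.
  by have := gw0; rewrite /gw (eq_bigr gv) // => b _; rewrite muln0 expr0 scale1r.
have h1 := low gv dge_gv sgv.
have h2 := low (fun=> 0) (fun=> @dge0 C m 1) (big1 _ _ _ (fun _ _ => erefl)).
have hs := @sum_gF mu%:MP z%:MP (z^-1)%:MP.
rewrite -mpolyCM mulfV // mpolyC1 in hs.
(* Collects the other diagonal entries, the two normalizations in [four] and the unit of
   [gw_flip]. *)
pose K := P * (q%:R^-1 * (- om ^+ k.+1) * q%:R^-1).
have K0 : K != 0 by rewrite !mulf_neq0 ?invr_eq0 ?oppr_eq0.
exists (fun j => K^-1 * mu ^+ (q - 2 * j.+1)).
have -> : \sum_(j0 < m) (K^-1 * mu ^+ (q - 2 * j0.+1)) *: gF C j0 - gw k.+1 ^+ 2 =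
  K^-1 *: (\sum_(j < m) gF C j * mu%:MP ^+ (q - 2 * j.+1) - K *: gw k.+1 ^+ 2).
  rewrite scalerBr scalerA mulVf // scale1r scaler_sumr; congr (_ - _).
  by apply: eq_bigr => l _; rewrite -rmorphXn /= [_ * _%:MP]mulrC mul_mpolyC scalerA.
apply: dgeZ; rewrite hs //.
have -> : \det (perM (fun _ : 'I_q => mu%:MP) z%:MP (z^-1)%:MP) =
   \det (perM (fun _ : 'I_q => mu%:MP - 0 : B) z%:MP (z^-1)%:MP) by rewrite subr0.
have f0 : four om (fun=> 0 : B) i j = 0 by rewrite /four big1 // => a _; rewrite scaler0.
rewrite f0 mul0r scaler0 addr0 in h2.
have fK : P *: (four om gv i j * four om gv j i) = K *: gw k.+1 ^+ 2.
  rewrite fij fji (@gw_flip k.+1) ?subnKC //; last exact: ltnW.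
  by rewrite !scalerA -scalerAl -scalerAr !scalerA expr2; congr (_ *: _); rewrite /K; ring.
rewrite -fK -addrA -opprD; apply: dgeD => //; exact: dgeN.
Qed.

Theorem exists_isospectral_1d : exists v : 'I_q -> C, (exists a, v a != 0) /\
  forall x y, x * y = 1 ->
    \det (perM (fun a => 'X - (v a)%:P) x%:P y%:P) = \det (perM (fun _ : 'I_q => 'X) x%:P y%:P).
Proof.
have hm : (1 < m)%N by lia.
have hme : (2 * m <= q)%N by lia.
have hF i : \sum_(j < m) gF C j * 'X_i ^+ (e.+1 - 2 * j.+1) = 'X_i ^+ q - gL i.
  by rewrite /gL opprB addrC subrK.
have hw k : dge 1 (gw k) by apply: dge_sum => b _; apply: dgeZ; exact: dge_gv.
have [c hc] := fin_all_exists (fun i : 'I_m => gv_span (widen_ord (@half_le e) i)).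
have hX (i : 'I_m) : 'X_i = \sum_k c i k *: gw k.+1 by rewrite -hc gv_widen.
have [t [[i ti] ht]] := common_zero hm hme dle_gL hF (fun k : 'I_m => hw k.+1) hX gF_quadratic.
exists (asym t); split; first by exists (widen_ord (@half_le e) i); rewrite asym_widen.
move=> x y xy; apply/eqP; rewrite -subr_eq0; apply/eqP.
have h0 : map_poly (meval t) (gdiff C e) = 0.
  rewrite gdiff_expand // rmorphN rmorph_sum big1 ?oppr0 // => j _.
  by rewrite -mul_polyC rmorphM /= map_polyC /= ht polyC0 mul0r.
rewrite -h0 (@gdiffE _ _ q4 x%:MP%:P y%:MP%:P) -?polyCM -?mpolyCM ?xy ?mpolyC1 ?polyC1 //.
rewrite rmorphB /= -!det_map_mx !map_perM /=; congr (_ - _); congr (determinant _).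
  apply/matrixP => a b; rewrite !mxE /= rmorphB /= map_polyX !map_polyC /= !mevalC.
  by rewrite meval_gv.
by apply/matrixP => a b; rewrite !mxE /= map_polyX !map_polyC /= !mevalC.
Qed.
End Existence1D.

(** * Matrices given by kernels on a finite type *)

Section KernelMatrix.
Variables (A : comNzRingType) (T : finType).
Implicit Types K : T -> T -> A.

Definition mxK K : 'M[A]_#|T| := \matrix_(i, j) K (enum_val i) (enum_val j).

Lemma sum_enum_val (F : T -> A) : \sum_(i < #|T|) F (enum_val i) = \sum_a F a.
Proof. by rewrite [RHS](reindex _ (onW_bij _ (@enum_val_bij T))). Qed.

Lemma eq_mxK K K' : (forall a b, K a b = K' a b) -> mxK K = mxK K'.
Proof. by move=> h; apply/matrixP => i j; rewrite !mxE h. Qed.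

Lemma mulmxK K K' : mxK K *m mxK K' = mxK (fun a b => \sum_c K a c * K' c b).
Proof.
apply/matrixP => i j; rewrite !mxE -sum_enum_val.
by apply: eq_bigr => k _; rewrite !mxE.
Qed.

Lemma mxK1 : mxK (fun a b => (a == b)%:R) = 1%:M.
Proof. by apply/matrixP => i j; rewrite !mxE (inj_eq enum_val_inj). Qed.

End KernelMatrix.

Lemma char_poly_mxKE (A : comNzRingType) (T : finType) (K : T -> T -> A) :
  char_poly (mxK K) = \det (mxK (fun a b => 'X *+ (a == b) - (K a b)%:P)).
Proof.
by congr (determinant _); apply/matrixP => i j; rewrite !mxE (inj_eq enum_val_inj).
Qed.

Lemma det_mxK_reindex (A : comNzRingType) (T : finType) (K : T -> T -> A) (h : T -> T) :
  injective h -> \det (mxK (fun a b => K (h a) (h b))) = \det (mxK K).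
Proof.
move=> hi; pose f (i : 'I_#|T|) := enum_rank (h (enum_val i)).
have fi : injective f by move=> i j /enum_rank_inj/hi/enum_val_inj.
have -> : mxK (fun a b => K (h a) (h b)) = row_perm (perm fi) (col_perm (perm fi) (mxK K)).
  by apply/matrixP => i j; rewrite !mxE !permE /f !enum_rankK.
rewrite row_permE col_permE !det_mulmx !det_perm odd_permV.
by rewrite mulrCA -signr_addb addbb mulr1.
Qed.

Lemma char_poly_reindex (A : comNzRingType) (T : finType) (K : T -> T -> A) (h : T -> T) :
  injective h -> char_poly (mxK (fun a b => K (h a) (h b))) = char_poly (mxK K).
Proof.
move=> hi; rewrite !char_poly_mxKE -[RHS](det_mxK_reindex _ hi); congr (determinant _).
by apply: eq_mxK => a b; rewrite (inj_eq hi).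
Qed.

Lemma char_poly_intertwine (F : fieldType) n (S M N : 'M[F]_n) :
  S \in unitmx -> M *m S = S *m N -> char_poly M = char_poly N.
Proof.
move=> uS MS; have dS : (\det S)%:P != 0 by rewrite polyC_eq0 -unitfE -unitmxE.
apply: (mulIf dS); rewrite [RHS]mulrC /char_poly -det_map_mx -!det_mulmx; congr (determinant _).
rewrite /char_poly_mx mulmxBl mulmxBr -!map_mxM MS; congr (_ - _).
by rewrite scalar_mxC.
Qed.

(* If [s] moves some index up in the grading [f] the term vanishes; otherwise, [s] being a
   permutation, it preserves [f]. *)
Lemma det_block_trig (A : comNzRingType) n (M M' : 'M[A]_n) (f : 'I_n -> nat) :
  (forall i j, (f i < f j)%N -> M i j = 0) -> (forall i j, (f i < f j)%N -> M' i j = 0) ->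
  (forall i j, f i = f j -> M i j = M' i j) -> \det M = \det M'.
Proof.
move=> h h' e; apply: eq_bigr => s _; congr (_ * _).
have [/forallP hs|] := boolP [forall i, (f (s i) <= f i)%N].
  apply: eq_bigr => i _; apply: e.
  have : (\sum_i (f i - f (s i)) = 0)%N.
    rewrite sumnB //= [X in (X - _)%N](reindex_inj (@perm_inj _ s)) /=; exact: subnn.
  move/eqP; rewrite sum_nat_eq0 => /forallP/(_ i)/= /eqP hi; have := hs i; lia.
rewrite negb_forall; case/existsP => i; rewrite -ltnNge => hi.
by rewrite (bigD1 i) //= h // mul0r (bigD1 i) //= h' // mul0r.
Qed.

Lemma det_mxK_trig (A : comNzRingType) (T : finType) (K K' : T -> T -> A) (f : T -> nat) :
  (forall a b, (f a < f b)%N -> K a b = 0) -> (forall a b, (f a < f b)%N -> K' a b = 0) ->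
  (forall a b, f a = f b -> K a b = K' a b) -> \det (mxK K) = \det (mxK K').
Proof.
move=> h h' e; apply: (@det_block_trig _ _ _ _ (fun i => f (enum_val i))) => i k fik; rewrite !mxE.
- exact: h.
- exact: h'.
exact: e.
Qed.

(** * Changing one coordinate of a point of the box *)

Section Box.
Variables (d : nat) (q : 'I_d -> nat).
Local Notation box := (box q).

Definition upd (a : box) (j : 'I_d) (x : 'I_(q j)) : box := [ffun i => dfwith a x i].

Lemma updE a j x : upd a x j = x :> 'I_(q j).
Proof. by rewrite ffunE dfwith_in. Qed.

Lemma upd_other a j (x : 'I_(q j)) i : i != j -> upd a x i = a i.
Proof. by move=> ij; rewrite ffunE dfwith_out 1?eq_sym. Qed.

Lemma upd_id (a : box) j : upd a (a j) = a.
Proof. by apply/ffunP => i; have [->|ij] := eqVneq i j; rewrite ?updE ?upd_other. Qed.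

Lemma upd_upd (a : box) j (x y : 'I_(q j)) : upd (upd a x) y = upd a y.
Proof. by apply/ffunP => i; have [->|ij] := eqVneq i j; rewrite ?updE ?upd_other. Qed.

Lemma updC (a : box) i j (x : 'I_(q i)) (y : 'I_(q j)) : i != j -> upd (upd a x) y = upd (upd a y) x.
Proof.
move=> ij; apply/ffunP => k; have [->|kj] := eqVneq k j.
  by rewrite updE upd_other 1?eq_sym // updE.
rewrite (@upd_other _ j) //; have [->|ki] := eqVneq k i; first by rewrite !updE.
by rewrite !upd_other.
Qed.

(** This boolean is how the kernels below express that two points agree off the [j]-th
    coordinate. *)
Lemma upd_eqP (a b : box) j : reflect (forall i, i != j -> b i = a i) (b == upd a (b j)).
Proof.
apply: (iffP eqP) => [-> i ij|h]; first by rewrite upd_other.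
by apply/ffunP => i; have [->|ij] := eqVneq i j; [rewrite updE|rewrite upd_other ?h].
Qed.

Lemma upd_sym (a b : box) j : (b == upd a (b j)) = (a == upd b (a j)).
Proof. by apply/upd_eqP/upd_eqP => h i ij; rewrite h. Qed.

Lemma eq_box (a b : box) j : (a == b) = (a j == b j) && (b == upd a (b j)).
Proof.
have [<-|ab] := eqVneq a b; first by rewrite upd_id !eqxx.
case: eqP => //= e; apply/esym/negbTE; apply: contraNN ab => /eqP eb.
by rewrite eb -e upd_id.
Qed.

Lemma eq_upd (a b : box) j (x : 'I_(q j)) : (upd b x == upd a x) = (b == upd a (b j)).
Proof.
apply/eqP/upd_eqP => [h i ij|h].
  by have := congr1 (fun c : box => c i) h; rewrite !upd_other.
by apply/ffunP => i; have [->|ij] := eqVneq i j; [rewrite !updE|rewrite !upd_other ?h].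
Qed.

Lemma sum_fiber (S : nmodType) (F : box -> S) a j :
  \sum_(c : box) F c *+ (c == upd a (c j)) = \sum_(x < q j) F (upd a x).
Proof.
rewrite (bigID (fun c : box => c == upd a (c j))) /= [X in _ + X]big1 ?addr0 => [|c /negPf ->]; last by rewrite mulr0n.
rewrite (reindex_onto (fun x => upd a x) (fun c : box => c j)) => [|c /eqP <-] //=.
apply: eq_big => [x|x _]; first by rewrite !updE !eqxx.
by rewrite updE eqxx.
Qed.
End Box.

(** * Exchanging one tensor factor for a matrix with the same characteristic polynomial *)

Section Tensor.
Variables (C : numClosedFieldType) (d : nat) (q : 'I_d -> nat) (j : 'I_d).
Local Notation box := (box q).
Hypothesis qj : (0 < q j)%N.

(** The tensor product of [M] in the [j]-th factor with the identity in all others. *)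
Definition ten (M : 'M[C]_(q j)) (a b : box) : C := M (a j) (b j) *+ (b == upd a (b j)).

Lemma ten_mull M K : mxK (ten M) *m mxK K =
  mxK (fun a b : box => \sum_(x < q j) M (a j) x * K (upd a x) b).
Proof.
rewrite mulmxK; apply: eq_mxK => a b.
rewrite (eq_bigr (fun c : box => (M (a j) (c j) * K c b) *+ (c == upd a (c j)))) => [|c _].
  by rewrite sum_fiber; apply: eq_bigr => x _; rewrite updE.
by rewrite mulrnAl.
Qed.

Lemma ten_mulr M K : mxK K *m mxK (ten M) =
  mxK (fun a b : box => \sum_(x < q j) K a (upd b x) * M x (b j)).
Proof.
rewrite mulmxK; apply: eq_mxK => a b.
rewrite (eq_bigr (fun c : box => (K a c * M (c j) (b j)) *+ (c == upd b (c j)))) => [|c _].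
  by rewrite sum_fiber; apply: eq_bigr => x _; rewrite updE.
by rewrite /ten mulrnAr upd_sym.
Qed.

Lemma ten_mul M N : mxK (ten M) *m mxK (ten N) = mxK (ten (M *m N)).
Proof.
rewrite ten_mull; apply: eq_mxK => a b; rewrite /ten mxE -sumrMnl; apply: eq_bigr => x _.
by rewrite updE upd_upd mulrnAr.
Qed.

Lemma ten1 : mxK (ten 1%:M) = 1%:M.
Proof.
rewrite -mxK1; apply: eq_mxK => a b; rewrite /ten mxE.
by rewrite -mulrnA mulnb -eq_box.
Qed.

Variable B : box -> box -> C.
Hypothesis B0 : forall a b : box, a j != b j -> B a b = 0.
Hypothesis BS : forall (a b : box) (x : 'I_(q j)), a j = b j -> B (upd a x) (upd b x) = B a b.

Lemma ten_comm M : mxK (ten M) *m mxK B = mxK B *m mxK (ten M).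
Proof.
rewrite ten_mull ten_mulr; apply: eq_mxK => a b.
rewrite (bigD1 (b j)) //= big1 ?addr0 => [|x xb]; last by rewrite B0 ?mulr0 // updE.
rewrite (bigD1 (a j)) //= big1 ?addr0 => [|x xa]; last by rewrite B0 ?mul0r // updE eq_sym.
by rewrite mulrC -(@BS _ _ (a j)) ?updE // upd_upd upd_id.
Qed.

Definition tenD M a b := ten M a b + B a b.

Lemma mxK_tenD M : mxK (tenD M) = mxK (ten M) + mxK B.
Proof. by apply/matrixP => i k; rewrite !mxE. Qed.

Lemma char_poly_tenD_conj (P M N : 'M[C]_(q j)) : P \in unitmx -> P *m M = N *m P ->
  char_poly (mxK (tenD M)) = char_poly (mxK (tenD N)).
Proof.
move=> uP PM; apply/esym/(@char_poly_intertwine _ _ (mxK (ten P))).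
  suff : mxK (ten P) *m mxK (ten (invmx P)) = 1%:M by case/mulmx1_unit.
  by rewrite ten_mul mulmxV // ten1.
by rewrite !mxK_tenD mulmxDl mulmxDr !ten_mul PM ten_comm.
Qed.

(** Graded by the [j]-th coordinate, the matrix is block triangular, and its diagonal blocks see
    only the diagonal of [M]. *)
Lemma char_poly_tenD_trig (M : 'M[C]_(q j)) : is_trig_mx M ->
  char_poly (mxK (tenD M)) = char_poly (mxK (tenD (diag_mx (\row_x M x x)))).
Proof.
move=> /is_trig_mxP tM; rewrite !char_poly_mxKE.
have ne (a b : box) : (a j < b j)%N -> a j != b j by apply: contraTN => /eqP ->; rewrite ltnn.
have ne' (a b : box) : a j != b j -> (a == b) = false by apply: contraNF => /eqP ->.
apply: (@det_mxK_trig _ _ _ _ (fun a : box => a j : nat)) => a b ab; rewrite /tenD /ten.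
- by rewrite (B0 (ne _ _ ab)) (tM _ _ ab) (ne' _ _ (ne _ _ ab)) !mul0rn addr0 polyC0 subr0.
- by rewrite (B0 (ne _ _ ab)) (ne' _ _ (ne _ _ ab)) !mxE (negPf (ne _ _ ab)) mulr0n !mul0rn addr0 polyC0 subr0.
by rewrite !mxE (ord_inj ab) eqxx mulr1n.
Qed.

Lemma trig_conj (M : 'M[C]_(q j)) : exists P T, [/\ P \in unitmx, is_trig_mx T & P *m M = T *m P].
Proof.
have [P uP tP] := Schur M qj; have uP' : P \in unitmx by exact: unitarymx_unit.
exists P, (P *m M *m invmx P); split=> //; last by rewrite mulmxKV.
by move: tP; rewrite -conjumx.
Qed.

(** By [B0] and [BS], [B] is the identity in the [j]-th factor and commutes with every change of
    basis there. So both matrices may be triangularized and then replaced by their diagonals, which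
    agree up to order. *)
Theorem char_poly_tenD (M N : 'M[C]_(q j)) : char_poly M = char_poly N ->
  char_poly (mxK (tenD M)) = char_poly (mxK (tenD N)).
Proof.
move=> MN.
have [P [T [uP tT hP]]] := trig_conj M; have [Q [S [uQ tS hQ]]] := trig_conj N.
rewrite (char_poly_tenD_conj uP hP) (char_poly_tenD_conj uQ hQ).
rewrite (char_poly_tenD_trig tT) (char_poly_tenD_trig tS).
have cT : char_poly M = char_poly T.
  by apply/esym/(@char_poly_intertwine _ _ P).
have cS : char_poly N = char_poly S.
  by apply/esym/(@char_poly_intertwine _ _ Q).
have : perm_eq [tuple T x x | x < q j] [tuple S x x | x < q j].
  apply: prod_XsubC_eq; rewrite !big_map -!enumT /= !big_enum /=.
  by rewrite -!char_poly_trig // -cT -cS.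
case/tuple_permP => s /val_inj es.
have hs x : T x x = S (s x) (s x).
  by have := congr1 (fun t => tnth t x) es; rewrite !tnth_mktuple.
(* Relabelling the [j]-th coordinate by [s] matches the two diagonals and leaves [B] as it is. *)
rewrite -[RHS](@char_poly_reindex _ _ _ (fun a : box => upd a (s (a j)))).
  congr (char_poly _); apply: eq_mxK => a b; rewrite /tenD /ten !mxE !updE hs (inj_eq perm_inj).
  have [e|ne] := eqVneq (a j) (b j); last by rewrite !B0 ?mul0rn ?updE ?(inj_eq perm_inj).
  by rewrite e BS // upd_upd eq_upd.
move=> a b e.
have eab : a j = b j.
  by have := congr1 (fun c : box => c j) e; rewrite !updE => /perm_inj.
by have := congr1 (fun c => upd c (a j)) e; rewrite !upd_upd {2}eab !upd_id.
Qed.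
End Tensor.

(** * The Floquet matrix in a translation invariant gauge *)

Definition hopM (C : fieldType) n (x : C) : 'M[C]_n :=
  \matrix_(a, b) (x *+ (b == ordS a) + x^-1 *+ (a == ordS b)).

(** Here every hop in direction [i] carries [ze i] or its inverse, whereas [Lentry] puts the whole
    factor on the hops that leave the box. *)
Definition Lg (C : numClosedFieldType) d (q : 'I_d -> nat) (v : box q -> C) (ze : 'I_d -> C) (a b : box q) : C :=
  v a *+ (a == b) + \sum_i ten (hopM (q i) (ze i)) a b.

Section Gauge.
Variables (R : realType) (d : nat) (q : 'I_d -> nat).
Local Notation C := R[i].
Local Notation box := (box q).
Hypothesis qpos : forall j, (0 < q j)%N.

Lemma red_eqE (n : pt d) (a b : box) i : (forall j, j != i -> n ord0 j = (a j)%:Z) ->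
  red_eq n b = ((n ord0 i %% q i)%Z == b i :> int) && (b == upd a (b i)).
Proof.
move=> hn; apply/forallP/andP => [h|[h1 /upd_eqP h2] j].
  split; first exact: h.
  apply/upd_eqP => j ji; apply: ord_inj; have := h j; rewrite hn // modz_nat modn_small ?ltn_ord //.
  by move=> /eqP [].
have [->//|ji] := eqVneq j i.
by rewrite hn // modz_nat modn_small ?ltn_ord // h2.
Qed.

Lemma red_plus (a b : box) i :
  red_eq (box_pt a + delta i) b = (b i == ordS (a i)) && (b == upd a (b i)).
Proof.
rewrite (@red_eqE _ a b i) => [|j ji]; last by rewrite !mxE eqxx (negPf ji) addr0.
congr (_ && _); rewrite !mxE !eqxx -PoszD addn1 modz_nat.
by rewrite -(inj_eq (@ord_inj _)) eq_sym.
Qed.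

Lemma red_minus (a b : box) i :
  red_eq (box_pt a - delta i) b = (a i == ordS (b i)) && (b == upd a (b i)).
Proof.
rewrite (@red_eqE _ a b i) => [|j ji]; last by rewrite !mxE eqxx (negPf ji) subr0.
congr (_ && _); rewrite !mxE !eqxx.
rewrite -[(b i : nat)%:Z](modz_small (d := q i)) ?ltz_nat ?ltn_ord ?andbT //.
rewrite -(eqz_modDr 1) subrK -PoszD addn1 !modz_nat eqz_nat modn_small //.
Qed.

Definition twist (ze : 'I_d -> C) (b : box) : C := \prod_j ze j ^+ b j.

(** Division with remainder in the exponent: [ffactor] accounts for the quotient and [twist] for the
    remainder. *)
Lemma ffactor_twist ze (n : pt d) (b : box) : (forall j, ze j != 0) -> red_eq n b ->
  ffactor q (fun j => ze j ^+ q j) n * twist ze b = \prod_j ze j ^ n ord0 j.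
Proof.
move=> z0 /forallP hn; rewrite -big_split; apply: eq_bigr => j _ /=.
have /eqP hj := hn j.
rewrite [in RHS](divz_eq (n ord0 j) (q j)) hj expfzDr // /quot !exprnP exprz_exp.
by rewrite [(q j : int) * _]mulrC.
Qed.

Lemma prod_delta ze (a : box) i (s : int) : (forall j, ze j != 0) ->
  \prod_j ze j ^ ((box_pt a) ord0 j + s * delta i ord0 j) = twist ze a * ze i ^ s.
Proof.
move=> z0; rewrite (bigD1 i) //= /twist [in RHS](bigD1 i) //= !mxE !eqxx mulr1 expfzDr // mulrAC.
congr (_ * _ * _); apply: eq_bigr => j ji.
by rewrite !mxE eqxx (negPf ji) mulr0 addr0.
Qed.

Lemma Lentry_twist (V : pt d -> C) ze a b : (forall j, ze j != 0) ->
  Lentry V (fun j => ze j ^+ q j) a b * twist ze b = twist ze a * Lg (V \o @box_pt d q) ze a b.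
Proof.
move=> z0; rewrite /Lentry /Lg mulrDl mulrDr; congr (_ + _).
  by case: eqP => [->|_]; rewrite ?mul1r ?mulr1n ?mulr0n ?mul0r ?mulr0 // mulrC.
rewrite mulr_suml mulr_sumr; apply: eq_bigr => i _; rewrite big_bool /= mulrDl.
rewrite /ten mxE mulrnDl -!mulrnA !mulnb -red_plus -red_minus mulrDr; congr (_ + _).
  case h: (red_eq _ _); last by rewrite !mul0r mulr0n mulr0.
  rewrite mul1r ffactor_twist // mulr1n -[RHS](prod_delta a i 1 z0).
  by apply: eq_bigr => j _; rewrite mul1r !mxE.
case h: (red_eq _ _); last by rewrite !mul0r mulr0n mulr0.
rewrite mul1r ffactor_twist // mulr1n -(prod_delta a i (-1) z0).
by apply: eq_bigr => j _; rewrite mulN1r !mxE.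
Qed.

(** The two matrices are conjugate by the diagonal matrix with entries [twist ze a]. *)
Lemma char_poly_gauge (V : pt d -> C) ze : (forall j, ze j != 0) ->
  char_poly (LV q V (fun j => ze j ^+ q j)) = char_poly (mxK (Lg (V \o @box_pt d q) ze)).
Proof.
move=> z0; have D0 a : twist ze a != 0 by apply/prodf_neq0 => j _; rewrite expf_neq0.
pose D (f : box -> C) := mxK (fun a b : box => f a *+ (a == b)).
have Dl f K : D f *m mxK K = mxK (fun a b => f a * K a b).
  rewrite mulmxK; apply: eq_mxK => a b; rewrite (bigD1 a) //= eqxx big1 ?addr0 // => c ca.
  by rewrite eq_sym (negPf ca) mul0r.
have Dr f K : mxK K *m D f = mxK (fun a b => K a b * f b).
  rewrite mulmxK; apply: eq_mxK => a b; rewrite (bigD1 b) //= eqxx big1 ?addr0 // => c cb.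
  by rewrite (negPf cb) mulr0.
apply: (@char_poly_intertwine _ _ (D (twist ze))).
  suff : D (twist ze) *m D (fun a => (twist ze a)^-1) = 1%:M by case/mulmx1_unit.
  rewrite Dl -mxK1; apply: eq_mxK => a b; case: eqP => _; last by rewrite !mulr0n mulr0.
  by rewrite mulfV.
rewrite Dl (Dr _ (Lentry V (fun j => ze j ^+ q j))); apply: eq_mxK => a b.
exact: Lentry_twist.
Qed.
End Gauge.

(** * Potentials depending on one coordinate, and the existence statement *)

Section SeparablePotential.
Variables (C : numClosedFieldType) (d : nat) (q : 'I_d -> nat).
Local Notation box := (box q).
Hypothesis qpos : forall j, (0 < q j)%N.

Lemma ten_off (i j : 'I_d) (M : 'M[C]_(q i)) (a b : box) : i != j -> a j != b j -> ten M a b = 0.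
Proof.
move=> ij ab; rewrite /ten; case: upd_eqP => [h|_]; last by rewrite mulr0n.
by case/eqP: ab; rewrite h // eq_sym.
Qed.

Lemma ten_upd (i j : 'I_d) (M : 'M[C]_(q i)) (a b : box) (x : 'I_(q j)) :
  i != j -> a j = b j -> ten M (upd a x) (upd b x) = ten M a b.
Proof.
move=> ij ab; rewrite /ten; congr (_ *+ nat_of_bool _); first by rewrite !upd_other.
apply/upd_eqP/upd_eqP => h k ki.
  have [->|kj] := eqVneq k j; first by rewrite ab.
  by have := h k ki; rewrite !upd_other.
have [->|kj] := eqVneq k j; first by rewrite !updE.
by rewrite !upd_other // h.
Qed.

(** An instance of [char_poly_tenD], the hops in the other directions forming [B]. *)
Lemma char_poly_separable (j : 'I_d) (v : 'I_(q j) -> C) ze :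
  char_poly (diag_mx (\row_x v x) + hopM (q j) (ze j)) = char_poly (hopM (q j) (ze j)) ->
  char_poly (mxK (Lg (fun a : box => v (a j)) ze)) = char_poly (mxK (Lg (fun=> 0) ze : box -> box -> C)).
Proof.
move=> hv; pose B a b : C := \sum_(i | i != j) @ten _ _ q i (hopM (q i) (ze i)) a b.
have E (v' : 'I_(q j) -> C) : mxK (Lg (fun a : box => v' (a j)) ze)
    = mxK (tenD B (diag_mx (\row_x v' x) + hopM (q j) (ze j))).
  apply: eq_mxK => a b; rewrite /Lg /tenD /B (bigD1 j) //= addrA; congr (_ + _).
  rewrite /ten [in RHS]mxE mulrnDl; congr (_ + _); rewrite !mxE -mulrnA mulnb.
  by rewrite (eq_box a b j).
have E0 : mxK (Lg (fun=> 0) ze : box -> box -> C) = _ := E (fun=> 0).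
apply: etrans (congr1 (@char_poly _ _) (E v)) (etrans _ (esym (congr1 (@char_poly _ _) E0))).
apply: char_poly_tenD => //.
- by move=> a b ab; rewrite /B big1 // => i ij; rewrite (ten_off _ ij).
- by move=> a b x ab; apply: eq_bigr => i ij; apply: ten_upd.
rewrite hv; congr (char_poly _); rewrite -[LHS]add0r; congr (_ + _).
by apply/matrixP => x y; rewrite !mxE mul0rn.
Qed.

Lemma exists_isospectral_cycle n : (3 < n)%N -> exists v : 'I_n -> C, (exists a, v a != 0) /\
  forall x, x != 0 -> char_poly (diag_mx (\row_a v a) + hopM n x) = char_poly (hopM n x).
Proof.
case: n => // e e4; have [th hth] := @prim_root_exists C (2 * e.+1) isT.
have [v [v0 hv]] := exists_isospectral_1d e4 hth.
exists v; split=> // x x0; have := hv x x^-1 (mulfV x0).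
have E u : \det (perM (fun a => 'X - (u a)%:P) x%:P x^-1%:P) = char_poly (diag_mx (\row_a u a) + hopM e.+1 x).
  congr (determinant _); apply/matrixP => a b; rewrite !mxE mulrnBl.
  by rewrite !rmorphD !rmorphMn /= [in RHS]opprD addrA.
rewrite E => ->; rewrite -[hopM e.+1 x]add0r.
rewrite [X in X + _](_ : 0 = diag_mx (\row_a (0 : C))) -?E.
  congr (determinant _); apply/matrixP => a b; rewrite !mxE.
  by rewrite polyC0 subr0.
by apply/matrixP => a b; rewrite !mxE mul0rn.
Qed.

End SeparablePotential.

Section Existence.
Variables (R : realType) (d : nat) (q : 'I_d -> nat).
Local Notation C := R[i].
Local Notation box := (box q).
Hypothesis qpos : forall j, (0 < q j)%N.

Lemma torus_root (z : 'I_d -> C) : on_torus z ->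
  exists ze : 'I_d -> C, (forall j, ze j != 0) /\ z = (fun j => ze j ^+ q j).
Proof.
move=> hz; exists (fun j => (q j).-root (z j)); split.
  by move=> j; rewrite rootC_eq0 // -normr_gt0 hz.
by apply: boolp.funext => j; rewrite rootCK.
Qed.

Theorem exists_isospectral_potential (j : 'I_d) : (3 < q j)%N ->
  exists V : pt d -> C, periodic q V /\ (exists n, V n != 0) /\
    floquet_isospectral q V (fun _ => 0).
Proof.
move=> hj; have [v [[a0 va0] hv]] := exists_isospectral_cycle C hj.
(* The remainder is always below [q j], so the default 0 is never taken. *)
pose V (n : pt d) : C := oapp v 0 (insub `|(n ord0 j %% q j)%Z|%N).
have VE (a : box) : V (box_pt a) = v (a j).
  by rewrite /V mxE modz_nat modn_small // valK.
exists V; split.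
  move=> n m hm; rewrite /V mxE; have /dvdzP[k ->] := hm j.
  by rewrite addrC modzMDl.
split.
  pose a : box := upd [ffun i => Ordinal (qpos i)] a0.
  by exists (box_pt a); rewrite VE updE.
move=> z /torus_root [ze [z0 ->]] lam; rewrite /sigma; congr (mup _ _).
rewrite !char_poly_gauge //.
have -> : V \o @box_pt d q = (fun a : box => v (a j)) by apply: boolp.funext => a; rewrite /= VE.
by apply: (char_poly_separable qpos); apply: hv.
Qed.
End Existence.

(** * Kernels as operators on functions, and a limit of determinants *)

Section KernelOperator.
Variables (C : fieldType) (T : finType).
Implicit Types (K : T -> T -> C) (f : T -> C).

Definition opK K f a := \sum_b K a b * f b.

Lemma det_mxK_eq0P K :
  \det (mxK K) = 0 <-> exists f, (exists a, f a != 0) /\ forall a, opK K f a = 0.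
Proof.
rewrite -det_tr; split=> [/eqP/det0P[u u0 uK]|[f [[a fa] fK]]].
  exists (fun a => u 0 (enum_rank a)); split.
    have /existsP[i hi] : [exists i, u 0 i != 0].
      apply: contraNT u0; rewrite negb_exists => /forallP h.
      by apply/eqP/rowP => i; rewrite mxE; apply/eqP; rewrite -[_ == _]negbK.
    by exists (enum_val i); rewrite enum_valK.
  move=> a; have /rowP/(_ (enum_rank a)) := uK; rewrite !mxE => h.
  rewrite -[RHS]h /opK -sum_enum_val; apply: eq_bigr => i _.
  by rewrite !mxE enum_rankK enum_valK mulrC.
apply/eqP/det0P; exists (\row_i f (enum_val i)).
  by apply: contraNneq fa => /rowP/(_ (enum_rank a)); rewrite !mxE enum_rankK => ->.
apply/rowP => i; have h := fK (enum_val i); rewrite /opK -sum_enum_val in h.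
rewrite !mxE -[RHS]h; apply: eq_bigr => k _.
by rewrite !mxE mulrC.
Qed.

Lemma opK_mul K K' f a : opK (fun a b => \sum_c K a c * K' c b) f a = opK K (opK K' f) a.
Proof.
rewrite /opK (eq_bigr (fun b => \sum_c K a c * K' c b * f b)) => [|b _]; last by rewrite mulr_suml.
rewrite exchange_big /=; apply: eq_bigr => c _; rewrite mulr_sumr; apply: eq_bigr => b _.
by rewrite mulrA.
Qed.

Lemma opKD K K' f a : opK (fun a b => K a b + K' a b) f a = opK K f a + opK K' f a.
Proof. by rewrite /opK -big_split; apply: eq_bigr => b _; rewrite mulrDl. Qed.

Lemma opK_delta (h : T -> T) (x : C) f a : opK (fun a b => x *+ (b == h a)) f a = x * f (h a).
Proof.
rewrite /opK (bigD1 (h a)) //= eqxx big1 ?addr0 // => b /negPf ->.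
by rewrite mulr0n mul0r.
Qed.

Lemma opK_diag (v : T -> C) f a : opK (fun a b => v a *+ (b == a)) f a = v a * f a.
Proof.
rewrite /opK (bigD1 a) //= eqxx big1 ?addr0 // => b /negPf ->.
by rewrite mulr0n mul0r.
Qed.
End KernelOperator.

Section Limit.
Variable C : numClosedFieldType.

(** A nonzero difference of size [n] would vanish at all [n]-th roots of unity, more than its degree
    allows. *)
Lemma circle_poly_eq (p p' : {poly C}) : (forall x, `|x| = 1 -> p.[x] = p'.[x]) -> p = p'.
Proof.
move=> h; apply/eqP; rewrite -subr_eq0; apply/negPn/negP => pp'.
pose n := size (p - p'); have n0 : (0 < n)%N by rewrite lt0n size_poly_eq0.
have [z hz] := @prim_root_exists C n n0.
pose rs := [seq z ^+ k | k <- iota 0 n].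
have : (size rs < n)%N.
  apply: max_poly_roots => //.
    apply/allP => _ /mapP[k _ ->]; apply/rootP; rewrite hornerD hornerN h ?subrr //.
    rewrite normrX (_ : `|z| = 1) ?expr1n //.
    apply/eqP; rewrite -(@pexpr_eq1 _ _ n) // -?normrX ?(prim_expr_order hz) ?normr1 //; exact: lt0n.
  rewrite map_inj_in_uniq ?iota_uniq // => k l; rewrite !mem_iota /= !add0n => kn ln /eqP.
  by rewrite (eq_prim_root_expr hz) !modn_small // => /eqP.
by rewrite size_map size_iota ltnn.
Qed.

(* As [Pi *m K = 0], left multiplication by [e^-1 *: Pi + (1 - Pi)] turns the pencil into a
   polynomial in [e], which can be evaluated at [e = 0]. *)
Lemma limit_det N (Pi K A0 A1 A0' A1' : 'M[C]_N) : Pi *m K = 0 ->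
  (forall e, `|e| = 1 -> \det (e *: (A0 + e *: A1) + K) = \det (e *: (A0' + e *: A1') + K)) ->
  \det (Pi *m A0 + K) = \det (Pi *m A0' + K).
Proof.
move=> PK h.
pose c (A : 'M[C]_N) := map_mx (@polyC C) A.
pose Q A B : 'M[{poly C}]_N := c Pi *m (c A + 'X *: c B)
   + (1%:M - c Pi) *m ('X *: (c A + 'X *: c B)) + c K.
pose QQ A B x : 'M[C]_N := Pi *m (A + x *: B) + (1%:M - Pi) *m (x *: (A + x *: B)) + K.
have QE A B x : (\det (Q A B)).[x] = \det (QQ A B x).
  rewrite -[LHS]/(horner_eval x _) -det_map_mx; congr (determinant _).
  have cE M : map_mx (horner_eval x) (c M) = M by apply/matrixP => i j; rewrite !mxE /horner_eval hornerC.
  have zE M : map_mx (horner_eval x) ('X *: M) = x *: map_mx (horner_eval x) M.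
    by rewrite map_mxZ /= horner_evalE hornerX.
  by rewrite /Q !map_mxD !map_mxM /= !map_mxD map_mxN !zE !map_mxD !zE map_mx1 !cE.
have key : \det (Q A0 A1) = \det (Q A0' A1').
  apply: circle_poly_eq => x x1; rewrite !QE.
  have x0 : x != 0 by rewrite -normr_gt0 x1.
  have fac A B : QQ A B x = (x^-1 *: Pi + (1%:M - Pi)) *m (x *: (A + x *: B) + K).
    rewrite mulmxDl !mulmxDr !mulmxBl !mul1mx PK subr0 -!scalemxAl PK scaler0 addr0.
    by rewrite -!scalemxAr !scalerA mulVf // scale1r /QQ mulmxBl mul1mx -!scalemxAr !addrA.
  by rewrite !fac !det_mulmx h.
have Q0 A B : QQ A B 0 = Pi *m A + K.
  by rewrite /QQ !scale0r addr0 mulmx0 addr0.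
by rewrite -(Q0 A0 A1) -(Q0 A0' A1') -!QE key.
Qed.
End Limit.

(** * Averages over the orbits of a map of order three *)

Section LineAverage.
Variables (C : numClosedFieldType) (T : finType) (tau s t : T -> T).
Hypothesis tau3 : forall a, tau (tau (tau a)) = a.
Hypothesis sE : forall a, s a = tau (t a).
Hypothesis t_onto : forall a, exists b, t b = a.
Hypothesis tC : forall a, t (tau a) = tau (t a).
Variable A0 A1 : T -> T -> C.
Hypothesis A0tau : forall a b, A0 (tau a) (tau b) = A0 a b.
Variable V : T -> C.

Let tau_inj : injective tau.
Proof. by move=> a b /(congr1 (tau \o tau)); rewrite /= !tau3. Qed.

Definition avg (f : T -> C) a := 3%:R^-1 * (f a + f (tau a) + f (tau (tau a))).
Definition avgK (a b : T) : C := 3%:R^-1 *+ (b == a) + (3%:R^-1 *+ (b == tau a) + 3%:R^-1 *+ (b == tau (tau a))).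
(** The dominant part of the pencil. As [s] is [t] followed by [tau], its average over an orbit of
    [tau] telescopes to 0. *)
Definition jumpK (a b : T) : C := 1 *+ (b == s a) + (-1) *+ (b == t a).

Lemma opK_avgK f a : opK avgK f a = avg f a.
Proof.
rewrite /avgK opKD (opK_delta id) opKD (opK_delta tau) (opK_delta (tau \o tau)) /= /avg.
by ring.
Qed.

Lemma opK_jumpK f a : opK jumpK f a = f (s a) - f (t a).
Proof. by rewrite /jumpK opKD !opK_delta mul1r mulN1r. Qed.

Lemma opK_A0_tau f a : opK A0 f (tau a) = opK A0 (f \o tau) a.
Proof. by rewrite /opK (reindex_inj tau_inj); apply: eq_bigr => b _; rewrite A0tau. Qed.

Lemma avg_jump : mxK avgK *m mxK jumpK = 0.
Proof.
rewrite mulmxK; apply/matrixP => i j; rewrite !mxE; set a := enum_val i; set b := enum_val j.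
rewrite -[LHS]/(opK avgK (fun c => jumpK c b) a) opK_avgK /avg /jumpK !sE !tC tau3.
by ring.
Qed.

Hypothesis isosp : forall e : C, `|e| = 1 ->
  \det (mxK (fun a b => e * (V a *+ (b == a) + A0 a b + e * A1 a b) + jumpK a b)) =
  \det (mxK (fun a b => e * (A0 a b + e * A1 a b) + jumpK a b)).

(** The jump kills the invariant [f], so the limiting determinant with [V] vanishes, and hence the
    free one. For a null vector [G] of the latter the jump of [G] is invariant, yet sums to 0 over
    each orbit; it is therefore 0, so [G] is invariant and the average acts on it trivially. *)
Lemma limit_avg f : (forall a, f (tau a) = f a) -> (exists a, f a != 0) ->
  (forall a, avg V a * f a + opK A0 f a = 0) ->
  exists G : T -> C, [/\ exists a, G a != 0, forall a, G (tau a) = G a & forall a, opK A0 G a = 0].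
Proof.
move=> ftau f0 hf.
pose B0 a b := V a *+ (b == a) + A0 a b.
have h3 : 3%:R != 0 :> C by rewrite pnatr_eq0.
have split_ (E : T -> T -> C) e :
    e *: (mxK E + e *: mxK A1) + mxK jumpK = mxK (fun a b => e * (E a b + e * A1 a b) + jumpK a b).
  by apply/matrixP => i j; rewrite !mxE.
have lim := @limit_det _ _ (mxK avgK) (mxK jumpK) (mxK B0) (mxK A1) (mxK A0) (mxK A1) avg_jump.
have sumE (E : T -> T -> C) : mxK avgK *m mxK E + mxK jumpK =
    mxK (fun a b => (\sum_c avgK a c * E c b) + jumpK a b).
  by rewrite mulmxK; apply/matrixP => i j; rewrite !mxE.
rewrite !sumE in lim.
have inv_jump (g : T -> C) : (forall a, g (tau a) = g a) -> forall a, g (s a) - g (t a) = 0.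
  by move=> hg a; rewrite sE hg subrr.
have det0 : \det (mxK (fun a b => (\sum_c avgK a c * B0 c b) + jumpK a b)) = 0.
  apply/det_mxK_eq0P; exists f; split=> // a.
  rewrite opKD opK_mul opK_jumpK inv_jump // addr0 opK_avgK /avg.
  have opB a' : opK B0 f a' = V a' * f a' + opK A0 f a' by rewrite /B0 opKD opK_diag.
  have hA a' : opK A0 f (tau a') = opK A0 f a'.
    by rewrite opK_A0_tau; apply: eq_bigr => b _ /=; rewrite ftau.
  by rewrite !opB !hA !ftau -[RHS](hf a) /avg; field.
have [G [G0 hG]] : exists f, (exists a, f a != 0) /\
    forall a, opK (fun a b => (\sum_c avgK a c * A0 c b) + jumpK a b) f a = 0.
  apply/det_mxK_eq0P; rewrite -lim // => e e1.
  by rewrite !split_ isosp.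
have eqG a : G (s a) - G (t a) = - avg (opK A0 G) a.
  by have := hG a; rewrite opKD opK_mul opK_jumpK opK_avgK => /eqP; rewrite addrC addr_eq0 => /eqP.
have avg_tau g a : avg g (tau a) = avg g a by rewrite /avg tau3; congr (_ * _); ring.
pose H a := G (s a) - G (t a).
have Htau a : H (tau a) = H a by rewrite /H !eqG avg_tau.
have H0 a : H a = 0.
  have : H a + H (tau a) + H (tau (tau a)) = 0 by rewrite /H !sE !tC tau3; ring.
  rewrite !Htau => /eqP; rewrite (_ : _ + _ = 3%:R * H a); last by ring.
  by rewrite mulf_eq0 (negPf h3) => /= /eqP.
have Gtau a : G (tau a) = G a.
  by have [b <-] := t_onto a; apply/eqP; rewrite -subr_eq0 -sE; apply/eqP/H0.
exists G; split=> // a.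
have hA a' : opK A0 G (tau a') = opK A0 G a'.
  by rewrite opK_A0_tau; apply: eq_bigr => b _ /=; rewrite Gtau.
have := eqG a; rewrite -/(H a) H0 /avg !hA => /esym/eqP; rewrite oppr_eq0 mulf_eq0 invr_eq0 (negPf h3) /=.
rewrite (_ : _ + _ = 3%:R * opK A0 G a); last by ring.
by rewrite mulf_eq0 (negPf h3) => /= /eqP.
Qed.
End LineAverage.

(** * Rigidity on a cycle of length three *)

Section Period3.
Variable C : numClosedFieldType.

Lemma det_mx33 (A : comNzRingType) (M : 'M[A]_3) :
  let m i j := M (inord i) (inord j) in
  \det M = m 0 0 * (m 1 1 * m 2 2 - m 1 2 * m 2 1) - m 0 1 * (m 1 0 * m 2 2 - m 1 2 * m 2 0)
     + m 0 2 * (m 1 0 * m 2 1 - m 1 1 * m 2 0).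
Proof.
move=> m.
have e (i j : 'I_3) : M i j = m i j by rewrite /m !inord_val.
rewrite (expand_det_row _ 0) !big_ord_recl big_ord0 /cofactor !(expand_det_row _ 0) !big_ord_recl !big_ord0.
rewrite /cofactor !det_mx11 !mxE !e /= /bump /=.
ring.
Qed.

Lemma eigen_perM n (w : 'I_n -> C) x mu : \det (perM (fun a => mu - w a) x x^-1) = 0 <->
  exists g : 'I_n -> C, (exists t, g t != 0) /\
    forall t, w t * g t + x * g (ordS t) + x^-1 * g (ord_pred t) = mu * g t.
Proof.
have mulE (g : 'cV[C]_n) t : (perM (fun a => mu - w a) x x^-1 *m g) t 0 =
    mu * g t 0 - (w t * g t 0 + x * g (ordS t) 0 + x^-1 * g (ord_pred t) 0).
  rewrite mxE (eq_bigr (fun b => (mu - w t) *+ (b == t) * g b 0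
     - (x *+ (b == ordS t) * g b 0 + x^-1 *+ (b == ord_pred t) * g b 0))) => [|b _]; last first.
    have -> : (b == ord_pred t) = (t == ordS b).
      by rewrite -(inj_eq (can_inj (@ordSK n))) ord_predK eq_sym.
    by rewrite !mxE mulrBl mulrDl [t == b]eq_sym.
  have one (f : C) (i : 'I_n) : \sum_b f *+ (b == i) * g b 0 = f * g i 0.
    rewrite (bigD1 i) //= eqxx mulr1n big1 ?addr0 // => b /negPf ->.
    by rewrite mulr0n mul0r.
  by rewrite sumrB big_split /= !one; ring.
rewrite -det_tr; split=> [/eqP/det0P[u u0 uK]|[g [[t gt] hg]]].
  exists (fun t => u 0 t); split.
    have /existsP[i hi] : [exists i, u 0 i != 0]; last by exists i.
    apply: contraNT u0; rewrite negb_exists => /forallP h.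
    by apply/eqP/rowP => i; rewrite mxE; apply/eqP; rewrite -[_ == _]negbK.
  move=> t; have := mulE u^T t; rewrite -[perM _ _ _]trmxK -trmx_mul uK !mxE => /esym/eqP.
  by rewrite subr_eq0 => /eqP.
apply/eqP/det0P; exists (\row_t g t).
  by apply: contraNneq gt => /rowP/(_ t); rewrite !mxE => ->.
apply/rowP => i; have := mulE (\row_t g t)^T i; rewrite -[perM _ _ _]trmxK -trmx_mul trmxK mxE => ->.
by rewrite !mxE hg subrr.
Qed.

(** Only the two permutations winding around the cycle see the twist. *)
Lemma det_perM3 (u : 'I_3 -> C) x : x != 0 ->
  \det (perM u x x^-1) = u (inord 0) * u (inord 1) * u (inord 2)
     - (u (inord 0) + u (inord 1) + u (inord 2)) - (x ^+ 3 + x ^- 3).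
Proof.
move=> x0; rewrite det_mx33 /= !mxE -!(inj_eq (@ord_inj 3)) !ordSE !inordK //=.
by rewrite ?mulr0n ?mulr1n; field.
Qed.

(** For a common eigenvalue [mu] the difference of the two cubic equations is a quadratic in [mu]
    whose coefficients come from the elementary symmetric functions of [w]. Three distinct [mu] make
    it vanish identically. The length is given by an equation so that it applies to [q i]. *)
Lemma rigid3 n (w : 'I_n -> C) : n = 3 ->
  (forall x mu, `|x| = 1 ->
     (exists g : 'I_n -> C, (exists t, g t != 0) /\
       forall t, w t * g t + x * g (ordS t) + x^-1 * g (ord_pred t) = mu * g t) ->
     (exists h : 'I_n -> C, (exists t, h t != 0) /\
       forall t, x * h (ordS t) + x^-1 * h (ord_pred t) = mu * h t)) ->
  forall t, w t = 0.
Proof.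
move=> n3; subst n => hw.
pose w0 := w (inord 0); pose w1 := w (inord 1); pose w2 := w (inord 2).
pose e1 := w0 + w1 + w2; pose e2 := w0 * w1 + w0 * w2 + w1 * w2; pose e3 := w0 * w1 * w2.
have common x : `|x| = 1 -> exists mu, mu ^+ 3 - 3%:R * mu = x ^+ 3 + x ^- 3 /\
    - e1 * mu ^+ 2 + e2 * mu + (e1 - e3) = 0.
  move=> x1; have x0 : x != 0 by rewrite -normr_gt0 x1.
  have [mu hmu] : exists mu, root (char_poly (diag_mx (\row_a w a) + hopM 3 x)) mu.
    by apply/closed_rootP; rewrite size_char_poly.
  have dw : \det (perM (fun a => mu - w a) x x^-1) = 0.
    rewrite -(rootP hmu) -[RHS]/(horner_eval mu _) -det_map_mx; congr (determinant _).
    apply/matrixP => a b; rewrite !mxE /= horner_evalE hornerD hornerN hornerMn hornerX hornerC.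
    by rewrite mulrnBl [in RHS]opprD addrA.
  have d0 : \det (perM (fun a : 'I_3 => mu - 0) x x^-1) = 0.
    apply/(@eigen_perM _ (fun=> 0)); have [|h [h0 hh]] := hw x mu x1; first exact/eigen_perM.
    by exists h; split=> // t; rewrite mul0r add0r hh.
  exists mu; move: dw d0; rewrite !det_perM3 // -/w0 -/w1 -/w2 => dw d0; split.
    by apply/eqP; rewrite -subr_eq0; apply/eqP; rewrite -[RHS]d0; ring.
  by rewrite -[RHS](subrr 0) -{1}dw -d0 /e1 /e2 /e3; ring.
pose D : {poly C} := - e1 *: 'X^2 + e2 *: 'X + (e1 - e3)%:P.
have DE mu : D.[mu] = - e1 * mu ^+ 2 + e2 * mu + (e1 - e3).
  by rewrite /D !hornerE.
(* The twists 1, -1 and [- 'i] give [x ^+ 3 + x ^- 3] the values 2, -2 and 0, so the three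
   eigenvalues are distinct. *)
have [m1 [h1 r1]] := common 1 (normr1 _).
have [m2 [h2 r2]] : exists mu, mu ^+ 3 - 3%:R * mu = (-1) ^+ 3 + (-1) ^- 3 /\
    - e1 * mu ^+ 2 + e2 * mu + (e1 - e3) = 0 by apply: common; rewrite normrN1.
have [m3 [h3 r3]] : exists mu, mu ^+ 3 - 3%:R * mu = (- 'i) ^+ 3 + (- 'i) ^- 3 /\
    - e1 * mu ^+ 2 + e2 * mu + (e1 - e3) = 0 by apply: common; rewrite normrN normCi.
have sD : (size D <= 3)%N.
  rewrite /D; apply: (leq_trans (size_polyD _ _)); rewrite geq_max.
  rewrite (leq_trans (size_polyC_leq1 _)) // andbT.
  apply: (leq_trans (size_polyD _ _)); rewrite geq_max.
  by rewrite !(leq_trans (size_scale_leq _ _)) ?size_polyXn ?size_polyX.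
have n4 : 4%:R != 0 :> C by rewrite pnatr_eq0.
have n2 : 2%:R != 0 :> C by rewrite pnatr_eq0.
have i3 : (- 'i) ^+ 3 + (- 'i) ^- 3 = 0 :> C.
  have -> : (- 'i) ^+ 3 = 'i :> C by rewrite exprS sqrrN sqrCi mulrN1 opprK.
  by rewrite invCi subrr.
rewrite i3 in h3.
rewrite (_ : 1 ^+ 3 + 1 ^- 3 = 2%:R) in h1; last by rewrite expr1n invr1.
rewrite (_ : (-1) ^+ 3 + (-1) ^- 3 = - 2%:R) in h2; last by rewrite -signr_odd /= expr1 invrN1; ring.
have D0 : D = 0.
  apply/eqP/negPn/negP => D0.
  have : (size [:: m1; m2; m3] < size D)%N.
    apply: max_poly_roots => //=; first by rewrite /root !DE r1 r2 r3 eqxx.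
    rewrite !inE andbT negb_or; apply/andP; split; first (apply/andP; split).
    - apply/eqP => m12; move: h1; rewrite m12 h2 => h; case/eqP: n4.
      have -> : 4%:R = 2%:R - (- 2%:R) :> C by ring.
      by rewrite h subrr.
    - by apply/eqP => m13; move: h1; rewrite m13 h3 => h; case/eqP: n2.
    - apply/eqP => m23; move: h2; rewrite m23 h3 => h; case/eqP: n2.
      by apply: oppr_inj; rewrite -h oppr0.
  by rewrite /= ltnNge sD.
have cD k : D`_k = - e1 *+ (k == 2)%N + e2 *+ (k == 1)%N + (e1 - e3) *+ (k == 0)%N.
  by rewrite /D !coefD !coefZ coefXn coefX coefC !mulr_natr; congr (_ + _); case: eqP.
have e10 : e1 = 0.
  by have := cD 2; rewrite D0 coef0 /= !mulr0n !addr0 mulr1n => /esym/eqP; rewrite oppr_eq0 => /eqP.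
have e20 : e2 = 0 by have := cD 1; rewrite D0 coef0 /= !mulr0n addr0 add0r mulr1n.
have e30 : e3 = 0.
  by have := cD 0; rewrite D0 coef0 /= !mulr0n !add0r mulr1n e10 add0r => /esym/eqP; rewrite oppr_eq0 => /eqP.
(* The values of [w] are the roots of a cubic that has become [y ^+ 3]. *)
have cub y : (y - w0) * (y - w1) * (y - w2) = 0 -> y = 0.
  rewrite (_ : _ * _ = y ^+ 3 - e1 * y ^+ 2 + e2 * y - e3); last by rewrite /e1 /e2 /e3; ring.
  by rewrite e10 e20 e30 !mul0r !subr0 addr0 => /eqP; rewrite expf_eq0 => /= /eqP.
move=> t; apply: cub.
have : t \in [:: inord 0; inord 1; inord 2 : 'I_3].
  by case: t => [[|[|[|k]]]] ht //; rewrite !inE -!(inj_eq (@ord_inj 3)) !inordK.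
by rewrite !inE => /or3P[] /eqP ->; rewrite -/w0 -/w1 -/w2 subrr ?mul0r ?mulr0 ?mul0r.
Qed.
End Period3.

(** * Operators with one or two directions of period three *)

Section Period3Operators.
Variables (C : numClosedFieldType) (T : finType).
Implicit Types (V : T -> C) (s : T -> T).

Lemma ord3_cases n (x y : 'I_n) : n = 3 -> [\/ y = x, y = ordS x | y = ordS (ordS x)].
Proof.
move=> n3; subst n; have : [|| y == x, y == ordS x | y == ordS (ordS x)].
  by rewrite -!(inj_eq (@ord_inj 3)) !ordSE; case: x y => [[|[|[|?]]] ?] [[|[|[|?]]] ?].
by case/or3P => /eqP ->; [apply: Or31|apply: Or32|apply: Or33].
Qed.

Lemma ordS3 n (x : 'I_n) : n = 3 -> ordS (ordS (ordS x)) = x.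
Proof. by move=> n3; subst n; apply: ord_inj; rewrite !ordSE; case: x => [[|[|[|?]]] ?]. Qed.

(** Reduces to [rigid3]. The eigenfunction [f] lives on [P], while the free eigenfunction [G] may
    live elsewhere; any orbit of [s] where it is nonzero gives one on the cycle. *)
Lemma rigid_line n (s : T -> T) (c : T -> 'I_n) (P : pred T) (W : T -> C) (w : 'I_n -> C) :
  n = 3 -> (forall a, c (s a) = ordS (c a)) -> (forall a, s (s (s a)) = a) ->
  (forall a, P (s a) = P a) -> (forall t, exists2 a, P a & c a = t) ->
  (forall a, P a -> W a = w (c a)) ->
  (forall x mu (g : 'I_n -> C), `|x| = 1 -> let f a := g (c a) *+ P a in
     (exists a, f a != 0) ->
     (forall a, W a * f a + x * f (s a) + x^-1 * f (s (s a)) = mu * f a) ->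
     exists G : T -> C, (exists a, G a != 0) /\
       forall a, x * G (s a) + x^-1 * G (s (s a)) = mu * G a) ->
  forall a, P a -> W a = 0.
Proof.
move=> n3 cs s3 Ps Pc Ww hyp a Pa; rewrite Ww //; apply: (rigid3 n3) => x mu x1 [g [[t gt] hg]].
have pred2 (y : 'I_n) : ord_pred y = ordS (ordS y) by apply: (can_inj (@ordSK n)); rewrite ord_predK ordS3.
have [||G [[b Gb] hG]] := hyp x mu g x1.
- by have [a' Pa' ca'] := Pc t; exists a'; rewrite Pa' ca'.
- move=> a'; rewrite !Ps !cs; case Pa': (P a'); last by rewrite !mulr0n !mulr0 !addr0.
  by rewrite !mulr1n Ww // -hg pred2.
pose h t' := if t' == c b then G b else if t' == ordS (c b) then G (s b) else G (s (s b)).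
have S1 (y : 'I_n) : (ordS y == y) = false.
  by rewrite eq_sym ordS_neq // n3.
have S2 (y : 'I_n) : (ordS (ordS y) == y) = false.
  by apply/negP => /eqP e; have := ordS3 y n3; rewrite e => /eqP; rewrite S1.
have h0 : h (c b) = G b by rewrite /h eqxx.
have h1 : h (ordS (c b)) = G (s b) by rewrite /h S1 eqxx.
have h2 : h (ordS (ordS (c b))) = G (s (s b)) by rewrite /h S2 S1.
exists h; split; first by exists (c b); rewrite h0.
move=> t'; rewrite pred2; have [->|->|->] := ord3_cases (c b) t' n3.
- by rewrite h0 h1 h2 hG.
- by rewrite (ordS3 _ n3) h0 h1 h2 -hG s3.
by rewrite !(ordS3 _ n3) h0 h1 h2 -hG !s3.
Qed.

Definition L2 V s1 s2 x1 x2 mu (a b : T) : C := V a *+ (b == a) +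
  (x1 *+ (b == s1 a) + x1^-1 *+ (b == s1 (s1 a)) + (x2 *+ (b == s2 a) + x2^-1 *+ (b == s2 (s2 a)))
   - mu *+ (b == a)).

Definition iso2 V s1 s2 := forall x1 x2 mu : C, `|x1| = 1 -> `|x2| = 1 ->
  \det (mxK (L2 V s1 s2 x1 x2 mu)) = \det (mxK (L2 (fun=> 0) s1 s2 x1 x2 mu)).

Lemma iso2C V s1 s2 : iso2 V s1 s2 -> iso2 V s2 s1.
Proof.
move=> h x1 x2 mu n1 n2; have := h x2 x1 mu n2 n1.
have E V' : mxK (L2 V' s1 s2 x2 x1 mu) = mxK (L2 V' s2 s1 x1 x2 mu).
  by apply: eq_mxK => a b; rewrite /L2 [X in X - _]addrC.
by rewrite !E.
Qed.

(** The square of a map of order three is its inverse, so only [x2] and its inverse change places.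
    This yields the second diagonal direction. *)
Lemma iso2V V s1 s2 : (forall a, s2 (s2 (s2 a)) = a) -> iso2 V s1 s2 -> iso2 V s1 (s2 \o s2).
Proof.
move=> s23 h x1 x2 mu n1 n2; have := h x1 x2^-1 mu n1.
have E V' : mxK (L2 V' s1 s2 x1 x2^-1 mu) = mxK (L2 V' s1 (s2 \o s2) x1 x2 mu).
  by apply: eq_mxK => a b; rewrite /L2 /= s23 invrK [X in _ + X - _]addrC.
by rewrite !E; apply; rewrite normfV n2 invr1.
Qed.

Section TwoDirections.
Variables (V : T -> C) (s1 s2 : T -> T).
Hypothesis s13 : forall a, s1 (s1 (s1 a)) = a.
Hypothesis s23 : forall a, s2 (s2 (s2 a)) = a.
Hypothesis sC : forall a, s1 (s2 a) = s2 (s1 a).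
Hypothesis iso : iso2 V s1 s2.

Lemma s1_inj : injective s1.
Proof. by move=> a b /(congr1 (s1 \o s1)); rewrite /= !s13. Qed.

(** Take [x1 = e^-1] and [x2 = - e^-1] and multiply by [e]: the forward hops become the jump between
    [s1] and [s2], [V - mu] has order [e] and the backward hops order [e ^+ 2]. If [mu] is the
    average at [a0], the indicator of its orbit solves the averaged problem, and the free one is
    solvable only for [mu = 0]. *)
Lemma diagonal_avg a0 : avg (s1 \o (s2 \o s2)) V a0 = 0.
Proof.
pose tau := s1 \o (s2 \o s2).
have tau3 a : tau (tau (tau a)) = a.
  by rewrite /tau /= !sC !s13 !s23.
have tau_inj : injective tau by move=> a b /(congr1 (tau \o tau)); rewrite /= !tau3.
pose mu := avg tau V a0.
pose f (a : T) : C := (a \in [:: a0; tau a0; tau (tau a0)])%:R.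
have ftau a : f (tau a) = f a.
  have e0 : (tau a == a0) = (a == tau (tau a0)) by rewrite -{1}(tau3 a0) (inj_eq tau_inj).
  rewrite /f !inE e0 !(inj_eq tau_inj).
  by case: (a == a0); case: (a == tau a0); case: (a == _).
pose A0 (a b : T) : C := - (mu *+ (b == a)).
pose A1 (a b : T) : C := 1 *+ (b == s1 (s1 a)) + (-1) *+ (b == s2 (s2 a)).
have opA0 g a : opK A0 g a = - mu * g a.
  by rewrite -(opK_diag (fun=> - mu)); apply: eq_bigr => b _; rewrite /A0 mulNrn.
have sE a : s1 a = tau (s2 a) by rewrite /tau /= s23.
have s2_onto a : exists b, s2 b = a by exists (s2 (s2 a)); rewrite s23.
have s2tau a : s2 (tau a) = tau (s2 a) by rewrite /tau /= !sC.
have A0tau a b : A0 (tau a) (tau b) = A0 a b by rewrite /A0 (inj_eq tau_inj).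
have isosp (e : C) : `|e| = 1 ->
  \det (mxK (fun a b => e * (V a *+ (b == a) + A0 a b + e * A1 a b) + jumpK C s1 s2 a b)) =
  \det (mxK (fun a b => e * (A0 a b + e * A1 a b) + jumpK C s1 s2 a b)).
  move=> e1; have e0 : e != 0 by rewrite -normr_gt0 e1.
  have E V' : mxK (fun a b => e * (V' a *+ (b == a) + A0 a b + e * A1 a b) + jumpK C s1 s2 a b)
      = e *: mxK (L2 V' s1 s2 e^-1 (- e^-1) mu).
    apply/matrixP => i j; rewrite !mxE /L2 /A0 /A1 /jumpK invrK invrN invrK.
    by field.
  have E0 : mxK (fun a b => e * (A0 a b + e * A1 a b) + jumpK C s1 s2 a b)
      = e *: mxK (L2 (fun=> 0) s1 s2 e^-1 (- e^-1) mu).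
    by rewrite -E; apply: eq_mxK => a b; rewrite mul0rn add0r.
  by rewrite E E0 !detZ iso // ?normrN normfV e1 invr1.
have f0 : exists a, f a != 0 by exists a0; rewrite /f inE eqxx oner_eq0.
have hf a : avg tau V a * f a + opK A0 f a = 0.
  rewrite opA0 -mulrDl; suff : f a = 0 \/ avg tau V a = mu.
    by case=> ->; rewrite ?mulr0 // subrr mul0r.
  rewrite /f !inE; case: or3P => [h|_]; [right|by left].
  by case: h => /eqP ->; rewrite /mu /avg ?tau3; congr (_ * _); ring.
have [G [[a Ga] Gtau hG]] := limit_avg tau3 sE s2_onto s2tau A0tau isosp ftau f0 hf.
by have /eqP := hG a; rewrite opA0 mulf_eq0 (negPf Ga) orbF oppr_eq0 => /eqP.
Qed.

(** Take [x1 = e^-1] and shift the spectral parameter by [e^-1] as well: multiplied by [e], these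
    form the jump between [s1] and the identity, and the hopping along [s2] stays at order [e]. *)
Lemma straight_avg (x mu : C) (f : T -> C) : `|x| = 1 -> (forall a, f (s1 a) = f a) -> (exists a, f a != 0) ->
  (forall a, avg s1 V a * f a + x * f (s2 a) + x^-1 * f (s2 (s2 a)) = mu * f a) ->
  exists G : T -> C, (exists a, G a != 0) /\
    forall a, x * G (s2 a) + x^-1 * G (s2 (s2 a)) = mu * G a.
Proof.
move=> x1 fs f0 hf.
pose A0 (a b : T) : C := x *+ (b == s2 a) + x^-1 *+ (b == s2 (s2 a)) - mu *+ (b == a).
pose A1 (a b : T) : C := 1 *+ (b == s1 (s1 a)).
have opA0 g a : opK A0 g a = x * g (s2 a) + x^-1 * g (s2 (s2 a)) - mu * g a.
  rewrite -(opK_delta s2) -(opK_delta (s2 \o s2)) -(opK_delta id) /= /opK -big_split -sumrB.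
  by apply: eq_bigr => b _; rewrite /A0 mulrBl mulrDl.
have s1_onto (a : T) : exists b, id b = a by exists a.
have A0tau a b : A0 (s1 a) (s1 b) = A0 a b by rewrite /A0 -!sC !(inj_eq s1_inj).
have isosp (e : C) : `|e| = 1 ->
  \det (mxK (fun a b => e * (V a *+ (b == a) + A0 a b + e * A1 a b) + jumpK C s1 id a b)) =
  \det (mxK (fun a b => e * (A0 a b + e * A1 a b) + jumpK C s1 id a b)).
  move=> e1; have e0 : e != 0 by rewrite -normr_gt0 e1.
  have x0 : x != 0 by rewrite -normr_gt0 x1.
  have E V' : mxK (fun a b => e * (V' a *+ (b == a) + A0 a b + e * A1 a b) + jumpK C s1 id a b)
      = e *: mxK (L2 V' s1 s2 e^-1 x (mu + e^-1)).
    apply/matrixP => i j; rewrite !mxE /L2 /A0 /A1 /jumpK invrK.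
    by field; rewrite e0 x0.
  have E0 : mxK (fun a b => e * (A0 a b + e * A1 a b) + jumpK C s1 id a b)
      = e *: mxK (L2 (fun=> 0) s1 s2 e^-1 x (mu + e^-1)).
    by rewrite -E; apply: eq_mxK => a b; rewrite mul0rn add0r.
  by rewrite E E0 !detZ iso // normfV e1 invr1.
have hf' a : avg s1 V a * f a + opK A0 f a = 0.
  by apply/eqP; rewrite opA0 !addrA subr_eq0 hf.
have [G [G0 _ hG]] := @limit_avg C T s1 s1 id s13 (fun a => erefl) s1_onto (fun a => erefl) A0 A1 A0tau V isosp f fs f0 hf'.
exists G; split=> // a; apply/eqP; rewrite -subr_eq0 -opA0; apply/eqP; exact: hG.
Qed.
End TwoDirections.
End Period3Operators.

(** * Rigidity when all periods are at most three *)

Section Rigidity.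
Variables (C : numClosedFieldType) (d : nat) (q : 'I_d -> nat).
Local Notation box := (box q).
Hypothesis qpos : forall j, (0 < q j)%N.

Definition shift (i : 'I_d) (a : box) : box := upd a (ordS (a i)).

Lemma ten_hopM i (x : C) (a b : box) :
  ten (hopM (q i) x) a b = x *+ (b == shift i a) + x^-1 *+ (a == shift i b).
Proof.
rewrite /ten mxE mulrnDl -!mulrnA !mulnb; congr (_ *+ nat_of_bool _ + _ *+ nat_of_bool _).
  by rewrite (eq_box b (shift i a) i) /shift updE eq_upd upd_sym.
by rewrite (eq_box a (shift i b) i) /shift updE eq_upd.
Qed.

(** For period at most 2 the forward and backward shifts coincide, and ['i] and its inverse
    cancel. *)
Lemma ten_hopM_small i (a b : box) : (q i <= 2)%N -> ten (hopM (q i) ('i : C)) a b = 0.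
Proof.
move=> q2; rewrite /ten mxE.
have -> : (b i == ordS (a i)) = (a i == ordS (b i)).
  have := ltn_ord (a i); have := ltn_ord (b i) => hb ha.
  rewrite -!(inj_eq (@ord_inj _)) !ordSE.
  by have [h1|h1] := eqVneq (a i).+1 (q i); have [h2|h2] := eqVneq (b i).+1 (q i); lia.
by rewrite invCi mulNrn addrN mul0rn.
Qed.

Lemma shift_coord i (a : box) : shift i a i = ordS (a i).
Proof. by rewrite /shift updE. Qed.

Lemma shift_other i j (a : box) : j != i -> shift i a j = a j.
Proof. by move=> ji; rewrite /shift upd_other. Qed.

Lemma shift3 i (a : box) : q i = 3 -> shift i (shift i (shift i a)) = a.
Proof.
move=> q3; apply/ffunP => j; have [->|ji] := eqVneq j i; first by rewrite !shift_coord ordS3.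
by rewrite !shift_other.
Qed.

Lemma shiftC i j (a : box) : i != j -> shift i (shift j a) = shift j (shift i a).
Proof.
by move=> ij; rewrite /shift !upd_other // 1?eq_sym // updC // eq_sym.
Qed.

Lemma shift_inv2 i (a b : box) : q i = 3 -> (a == shift i b) = (b == shift i (shift i a)).
Proof. by move=> q3; apply/eqP/eqP => ->; rewrite shift3. Qed.

Lemma upd_shift i (a : box) (x : 'I_(q i)) : q i = 3 ->
  [\/ upd a x = a, upd a x = shift i a | upd a x = shift i (shift i a)].
Proof.
move=> q3; have [->|->|->] := ord3_cases (a i) x q3; rewrite ?upd_id; first exact: Or31.
  exact: Or32.
by apply: Or33; rewrite {1}/shift shift_coord /shift upd_upd.
Qed.

Variable v : box -> C.
Hypothesis iso : forall ze, (forall j, `|ze j| = 1) -> forall mu,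
  \det (mxK (fun a b : box => Lg v ze a b - mu *+ (b == a))) =
  \det (mxK (fun a b : box => Lg (fun=> 0) ze a b - mu *+ (b == a))).

Lemma Lg_none (w : box -> C) : (forall j, (q j <= 2)%N) -> forall a b : box, Lg w (fun=> 'i) a b = w a *+ (b == a).
Proof.
move=> q2 a b; rewrite /Lg big1 ?addr0 => [|i _]; last exact: ten_hopM_small.
by rewrite eq_sym.
Qed.

Lemma Lg_one (w : box -> C) i x : q i = 3 -> (forall j, j != i -> (q j <= 2)%N) ->
  forall a b : box, Lg w (fun j => if j == i then x else 'i) a b =
    w a *+ (b == a) + (x *+ (b == shift i a) + x^-1 *+ (b == shift i (shift i a))).
Proof.
move=> q3 q2 a b; rewrite /Lg eq_sym (bigD1 i) //= eqxx big1 ?addr0 => [|j ji].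
  by rewrite ten_hopM (shift_inv2 a b q3).
by rewrite (negPf ji); apply: ten_hopM_small; exact: q2.
Qed.

Lemma Lg_two (w : box -> C) i k x y : i != k -> q i = 3 -> q k = 3 ->
  (forall j, j != i -> j != k -> (q j <= 2)%N) ->
  forall a b : box, Lg w (fun j => if j == i then x else if j == k then y else 'i) a b =
    w a *+ (b == a) + (x *+ (b == shift i a) + x^-1 *+ (b == shift i (shift i a))
                     + (y *+ (b == shift k a) + y^-1 *+ (b == shift k (shift k a)))).
Proof.
move=> ik q3 q3' q2 a b; rewrite /Lg eq_sym (bigD1 i) //= eqxx (bigD1 k) 1?eq_sym //=.
rewrite eqxx [k == i]eq_sym (negPf ik) big1 ?addr0 => [|j /andP[ji jk]].
  by rewrite !ten_hopM (shift_inv2 a b q3) (shift_inv2 a b q3').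
by rewrite (negPf ji) (negPf jk); apply: ten_hopM_small; exact: q2.
Qed.

(** Each value of [v] is an eigenvalue of a diagonal matrix isospectral to 0. *)
Lemma rigid_none : (forall j, (q j <= 2)%N) -> forall a, v a = 0.
Proof.
move=> q2 a; have n1 (j : 'I_d) : `|(fun _ : 'I_d => 'i : C) j| = 1 by exact: normCi.
have E (w : box -> C) : mxK (fun c b : box => Lg w (fun=> 'i) c b - v a *+ (b == c)) =
    mxK (fun c b : box => (w c - v a) *+ (b == c)).
  by apply: eq_mxK => c b; rewrite Lg_none // mulrnBl.
have := iso n1 (v a); rewrite !E => h.
have [G [[b Gb] hG]] : exists f, (exists a, f a != 0) /\
    forall c, opK (fun c b : box => (0 - v a) *+ (b == c)) f c = 0.
  apply/det_mxK_eq0P; rewrite -h; apply/det_mxK_eq0P.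
  exists (fun c => (c == a)%:R); split; first by exists a; rewrite eqxx oner_eq0.
  move=> c; rewrite opK_diag; case: eqP => [->|_]; last by rewrite mulr0.
  by rewrite subrr mul0r.
have /eqP := hG b; rewrite opK_diag mulf_eq0 (negPf Gb) orbF sub0r oppr_eq0.
by move/eqP.
Qed.

(** With the other directions switched off, distinct lines in direction [i] are uncoupled, so an
    eigenfunction on the line through [a0] extends by 0. *)
Lemma rigid_one i : q i = 3 -> (forall j, j != i -> (q j <= 2)%N) -> forall a, v a = 0.
Proof.
move=> q3 q2 a0; pose P (a : box) := [forall j, (j != i) ==> (a j == a0 j)].
have Pupd a : P a -> a = upd a0 (a i).
  move=> /forallP h; apply/eqP/upd_eqP => j ji; apply/eqP; exact: (implyP (h j)).
apply: (@rigid_line _ _ _ (shift i) (fun a : box => a i) P v (fun t => v (upd a0 t)) q3).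
- exact: shift_coord.
- by move=> a; rewrite shift3.
- by move=> a; apply: eq_forallb => j; case: eqP => //= /eqP ji; rewrite shift_other.
- move=> t; exists (upd a0 t); last by rewrite updE.
  by apply/forallP => j; apply/implyP => ji; rewrite upd_other.
- by move=> a /Pupd {1}->.
- move=> x mu g x1 f f0 hf.
  have n1 j : `|(fun j : 'I_d => if j == i then x else 'i) j| = 1.
    by case: eqP => _ //; exact: normCi.
  have E (w h : box -> C) (c : box) : opK (fun c b : box => Lg w (fun j : 'I_d => if j == i then x else 'i) c b - mu *+ (b == c)) h c =
      w c * h c + x * h (shift i c) + x^-1 * h (shift i (shift i c)) - mu * h c.
    rewrite -(opK_diag w) -(opK_delta (shift i)) -(opK_delta (shift i \o shift i)) -(opK_delta id) /= /opK.
    rewrite -!big_split -sumrB /=; apply: eq_bigr => b _.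
    by rewrite Lg_one // !mulrDl mulNr !addrA.
  have [G [G0 hG]] : exists f, (exists a, f a != 0) /\
    forall c, opK (fun c b : box => Lg (fun=> 0) (fun j : 'I_d => if j == i then x else 'i) c b - mu *+ (b == c)) f c = 0.
    apply/det_mxK_eq0P; rewrite -(iso n1); apply/det_mxK_eq0P; exists f; split=> // c.
    by rewrite E hf subrr.
  exists G; split=> // a; have /eqP := hG a; rewrite E mul0r add0r subr_eq0 => /eqP //.
by apply/forallP => j; rewrite eqxx implybT.
Qed.

Lemma iso2_shift i k : i != k -> q i = 3 -> q k = 3 ->
  (forall j, j != i -> j != k -> (q j <= 2)%N) -> iso2 v (shift i) (shift k).
Proof.
move=> ik q3 q3' q2 x y mu x1 y1.
have n1 j : `|(fun j : 'I_d => if j == i then x else if j == k then y else 'i) j| = 1.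
  by rewrite /=; case: (j == i); case: (j == k) => //; exact: normCi.
have := iso n1 mu.
have E (w : box -> C) : mxK (fun a b : box => Lg w (fun j : 'I_d => if j == i then x else if j == k then y else 'i) a b - mu *+ (b == a))
    = mxK (L2 w (shift i) (shift k) x y mu).
  by apply: eq_mxK => a b; rewrite Lg_two // /L2 -[LHS]addrA.
by rewrite !E.
Qed.

(** The average [W] is constant in direction [i], and by [straight_avg] its eigenvalues along
    direction [k] are free ones; so [rigid_line] applies on the plane through [a0]. *)
Lemma line_avg0 i k : i != k -> q i = 3 -> q k = 3 -> iso2 v (shift i) (shift k) ->
  forall a, avg (shift i) v a = 0.
Proof.
move=> ik q3 q3' hiso a0.
pose W := avg (shift i) v; pose P (a : box) := [forall j, (j != i) && (j != k) ==> (a j == a0 j)].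
have Ws a : W (shift i a) = W a by rewrite /W /avg shift3 //; congr (_ * _); ring.
have Wupd a (t : 'I_(q i)) : W (upd a t) = W a.
  by have [->|->|->] := upd_shift a t q3; rewrite ?Ws.
have Ps j a : j = i \/ j = k -> P (shift j a) = P a.
  move=> hj; apply: eq_forallb => l; case: (boolP (_ && _)) => //= /andP[li lk].
  by rewrite shift_other //; case: hj => ->.
apply: (@rigid_line _ _ _ (shift k) (fun a : box => a k) P W (fun t => W (upd a0 t)) q3').
- exact: shift_coord.
- by move=> a; rewrite shift3.
- by move=> a; apply: Ps; right.
- move=> t; exists (upd a0 t); last by rewrite updE.
  by apply/forallP => j; apply/implyP => /andP[ji jk]; rewrite upd_other.
- move=> a /forallP Pa; rewrite -[LHS](Wupd a (a0 i)); congr W.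
  apply/ffunP => j; have [->|jk] := eqVneq j k; first by rewrite updE upd_other // eq_sym.
  rewrite (@upd_other _ _ a0) //; have [->|ji] := eqVneq j i; first by rewrite updE.
  by rewrite upd_other //; apply/eqP; have /implyP := Pa j; rewrite ji jk; apply.
- move=> x mu g x1 f f0 hf.
  have s3 b : shift i (shift i (shift i b)) = b by exact: shift3.
  have sC b : shift i (shift k b) = shift k (shift i b) by exact: shiftC.
  apply: (straight_avg s3 sC hiso x1 _ f0 hf) => a.
  by rewrite /f Ps; [rewrite shift_other // eq_sym|left].
by apply/forallP => j; rewrite eqxx implybT.
Qed.

Lemma rigid_two i k : i != k -> q i = 3 -> q k = 3 ->
  (forall j, j != i -> j != k -> (q j <= 2)%N) -> forall a, v a = 0.
Proof.
move=> ik q3 q3' q2 a; have hiso := iso2_shift ik q3 q3' q2.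
have h3 : 3%:R != 0 :> C by rewrite pnatr_eq0.
have s3 b : shift i (shift i (shift i b)) = b by exact: shift3.
have t3 b : shift k (shift k (shift k b)) = b by exact: shift3.
have sC b : shift i (shift k b) = shift k (shift i b) by exact: shiftC.
have avg0 (tau : box -> box) b : avg tau v b = 0 -> v b + v (tau b) + v (tau (tau b)) = 0.
  by move/eqP; rewrite /avg mulf_eq0 invr_eq0 (negPf h3) => /= /eqP.
have r b := avg0 _ b (line_avg0 ik q3 q3' hiso b).
have ki : k != i by rewrite eq_sym.
have c := avg0 _ a (line_avg0 ki q3' q3 (iso2C hiso) a).
have d1 := avg0 _ a (diagonal_avg s3 t3 sC hiso a).
have t3' b : (shift k \o shift k) ((shift k \o shift k) ((shift k \o shift k) b)) = b by rewrite /= !t3.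
have sC' b : shift i ((shift k \o shift k) b) = (shift k \o shift k) (shift i b) by rewrite /= !sC.
have d2 := avg0 _ a (diagonal_avg s3 t3' sC' (iso2V t3 hiso) a).
move: d1 d2 c (r a) (r (shift k a)) (r (shift k (shift k a))).
rewrite /= -!sC !t3 => d1 d2 c _ r1 r2.
(* The lines through [a] in direction [k] and in the two diagonal directions cover [a] three times
   and, once each, the six points of the two lines in direction [i] that miss [a]. *)
have lin (x0 x1 x2 x3 x4 x5 x6 : C) : x0 + x5 + x4 = 0 -> x0 + x3 + x6 = 0 -> x0 + x1 + x2 = 0 ->
    x1 + x3 + x4 = 0 -> x2 + x5 + x6 = 0 -> 3%:R * x0 = 0.
  move=> e1 e2 e3 e4 e5.
  transitivity ((x0 + x5 + x4) + (x0 + x3 + x6) + (x0 + x1 + x2) - (x1 + x3 + x4) - (x2 + x5 + x6)).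
    by ring.
  by rewrite e1 e2 e3 e4 e5 !addr0 !subr0.
by have /eqP := lin _ _ _ _ _ _ _ d1 d2 c r1 r2; rewrite mulf_eq0 (negPf h3) => /= /eqP.
Qed.

Hypothesis q3 : forall j, (q j <= 3)%N.
Hypothesis card3 : (#|[set j | q j == 3%N]| <= 2)%N.

Theorem rigid a : v a = 0.
Proof.
have le2 j : q j != 3 -> (q j <= 2)%N by have := q3 j; lia.
case: (pickP (fun j => q j == 3)) => [i /eqP qi|h0]; last first.
  by apply: rigid_none => j; apply: le2; rewrite h0.
case: (pickP (fun j => (j != i) && (q j == 3))) => [k /andP[ki /eqP qk]|h1]; last first.
  by apply: (rigid_one qi) => j ji; apply: le2; have := h1 j; rewrite ji => /= ->.
apply: (rigid_two _ qi qk); first by rewrite eq_sym.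
move=> j ji jk; apply: le2; apply: contraTN card3 => /eqP qj.
rewrite -ltnNge; apply: (@leq_trans #|[set i; k; j]|).
  by rewrite setUC cardsU1 cards2 !inE negb_or ji jk eq_sym ki.
by apply/subset_leq_card/subsetP => l; rewrite !inE => /orP[/orP[]|] /eqP ->; apply/eqP.
Qed.
End Rigidity.

(** * From Floquet isospectrality to characteristic polynomials, and the conclusion *)

Lemma monic_mup_inj (C : numClosedFieldType) (p r : {poly C}) : p \is monic -> r \is monic ->
  (forall x, mup x p = mup x r) -> p = r.
Proof.
move=> /monicP mp /monicP mr h.
have [s es] := closed_field_poly_normal p; have [t et] := closed_field_poly_normal r.
rewrite mp scale1r in es; rewrite mr scale1r in et.
rewrite es et; apply: perm_big; apply/allP => x _ /=.
by rewrite -!mu_prod_XsubC -es -et h.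
Qed.

Lemma det_mxK_shift (C : fieldType) (T : finType) (K : T -> T -> C) mu :
  \det (mxK (fun a b => K a b - mu *+ (b == a))) = (-1) ^+ #|T| * (char_poly (mxK K)).[mu].
Proof.
rewrite char_poly_mxKE -[X in _ = _ * X]/(horner_eval mu _) -det_map_mx -detZ.
congr (determinant _); apply/matrixP => i j; rewrite !mxE /= ?horner_evalE hornerD hornerN hornerMn hornerX hornerC.
by rewrite mulN1r opprB eq_sym.
Qed.

(* Stated over an abstract field: unification is very slow on the structures of [R[i]]. *)
Definition charL (C : numClosedFieldType) d (q : 'I_d -> nat) (v : box q -> C) ze :=
  char_poly (mxK (Lg v ze)).

Lemma charL_rigid (C : numClosedFieldType) d (q : 'I_d -> nat) (v : box q -> C) :
  (forall ze, (forall j, `|ze j| = 1) -> charL v ze = charL (fun _ : box q => 0) ze) ->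
  (forall j, (q j <= 3)%N) -> (#|[set j | q j == 3%N]| <= 2)%N -> forall a, v a = 0.
Proof.
move=> h; apply: rigid => ze ze1 mu.
by rewrite !det_mxK_shift; congr (_ * _.[_]); apply: h.
Qed.

Section Bridge.
Variables (R : realType) (d : nat) (q : 'I_d -> nat).
Local Notation C := R[i].
Local Notation box := (box q).
Hypothesis qpos : forall j, (0 < q j)%N.

Lemma char_poly_LV (V : pt d -> C) ze : (forall j, ze j != 0) ->
  char_poly (LV q V (fun j => ze j ^+ q j)) = charL (V \o @box_pt d q) ze.
Proof. exact: char_poly_gauge. Qed.

Lemma isospectral_charL (V : pt d -> C) : floquet_isospectral q V (fun _ => 0) ->
  forall ze, (forall j, `|ze j| = 1) -> charL (V \o @box_pt d q) ze = charL (fun _ : box => 0) ze.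
Proof.
move=> iso ze ze1.
have ze0 j : ze j != 0 by rewrite -normr_gt0 ze1.
apply: etrans (esym (char_poly_LV V ze0)) (etrans _ (char_poly_LV (fun=> 0) ze0)).
apply: monic_mup_inj; [exact: char_poly_monic|exact: char_poly_monic|].
by apply: iso => j; rewrite normrX ze1 expr1n.
Qed.

Lemma periodic_box (V : pt d -> C) : periodic q V ->
  (forall a : box, V (box_pt a) = 0) -> forall n, V n = 0.
Proof.
move=> per h n.
have qi j : (q j)%:Z != 0 by rewrite eqz_nat -lt0n.
have lt j : (`|(n ord0 j %% q j)%Z|%N < q j)%N.
  by rewrite -ltz_nat gez0_abs ?modz_ge0 // ltz_pmod // ltz_nat.
pose a : box := [ffun j => Ordinal (lt j)].
have -> : n = box_pt a + \row_j ((n ord0 j %/ q j)%Z * q j).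
  apply/rowP => j; rewrite !mxE ffunE /= gez0_abs ?modz_ge0 // addrC.
  by rewrite {1}(divz_eq (n ord0 j) (q j)).
by rewrite per ?h // => j; rewrite mxE dvdz_mull.
Qed.
End Bridge.

Theorem theoremC (R : realType) (d : nat) (q : 'I_d -> nat) :
  (0 < d)%N -> (forall j, (0 < q j)%N) ->
  ((exists j, (3 < q j)%N) ->
     exists V : pt d -> R[i],
       periodic q V /\ (exists n, V n != 0) /\
       floquet_isospectral q V (fun _ => 0))
  /\
  ((forall j, (q j <= 3)%N) -> (#|[set j | q j == 3%N]| <= 2)%N ->
     forall V : pt d -> R[i],
       periodic q V -> floquet_isospectral q V (fun _ => 0) ->
       forall n, V n = 0).
Proof.
move=> _ qpos; split=> [[j hj]|q3 card3 V per iso].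
  exact: (exists_isospectral_potential R qpos hj).
apply: (periodic_box qpos per) => a.
exact: (charL_rigid (isospectral_charL iso) q3 card3 a).
Qed.
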